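(* Let $X$ be a nonempty compact subset of $\mathbb{C}$, and let $\mathcal{M}$ be a linear subspace of $C(X)$ such that $1\in\mathcal{M}$, $C^*(\mathcal{M})=C(X)$, and $X\neq\partial_{\mathcal{M}}X$, where $\partial_{\mathcal{M}}X$ is the Choquet boundary for $\mathcal{M}$. Then for every infinite-dimensional Hilbert space $\mathcal{H}$, there exist normal operators $T\in\boldsymbol{B}(\mathcal{H})$ and $\{T_n\}_{n=1}^\infty\subseteq\boldsymbol{B}(\mathcal{H})$, all with spectrum in $X$, such that (i) $\{T_n\}_{n=1}^\infty$ does not converge to $T$ in the strong operator topology; (ii) $\{f(T_n)\}_{n=1}^\infty$ converges in the weak operator topology for all $f\in C(X)$; (iii) $f(T_n)\to f(T)$ in the weak operator topology as $n\to\infty$ for all $f\in\mathcal{M}$; (iv) for every finite or countably infinite set $G$ of generators of $C(X)$ which is hyperrigid in $C(X)$, there exists $f_0\in G\setminus\mathcal{M}$ such that the weak operator topology limit of $\{f_0(T_n)\}_{n=1}^\infty$ is not equal to $f_0(T)$.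
   Context: Hilbert spaces are complex; $\boldsymbol{B}(\mathcal{H})$ denotes bounded linear operators on $\mathcal{H}$. $C(X)$ is the $C^*$-algebra of continuous complex functions on $X$ with the supremum norm; for nonempty $G\subseteq C(X)$, $C^*(G)$ is the smallest $C^*$-subalgebra of $C(X)$ containing $G\cup\{1\}$, and $G$ is a set of generators of $C(X)$ if $C^*(G)=C(X)$. For a normal operator $A$ with $\sigma(A)\subseteq X$ and $f\in C(X)$, $f(A)$ is given by the usual functional calculus. Choquet boundary: for a subspace $\mathcal{M}\subseteq C(X)$ with $1\in\mathcal{M}$, the state space $S(\mathcal{M})$ is the set of continuous linear functionals $L$ on $\mathcal{M}$ with $L(1)=1=\|L\|$; $\partial_{\mathcal{M}}X$ is the set of all $\lambda\in X$ such that the evaluation functional $\delta_\lambda\colon\mathcal{M}\ni f\mapsto f(\lambda)$ is an extreme point of $S(\mathcal{M})$. Hyperrigidity: a nonempty subset $G$ of a unital $C^*$-algebra $\mathscr{A}$ is hyperrigid (in $\mathscr{A}$) if for any faithful representation (unital $*$-homomorphism) $\pi\colon\mathscr{A}\to\boldsymbol{B}(\mathcal{L})$ on a Hilbert space $\mathcal{L}$ and any sequence $\Phi_k\colon\boldsymbol{B}(\mathcal{L})\to\boldsymbol{B}(\mathcal{L})$ ($k\in\mathbb{N}$) of unital completely positive linear maps, if $\lim_{k\to\infty}\|\Phi_k(\pi(g))-\pi(g)\|=0$ for all $g\in G$, then $\lim_{k\to\infty}\|\Phi_k(\pi(a))-\pi(a)\|=0$ for all $a\in\mathscr{A}$. 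*)

(* Defs.v *)
From HB Require Import structures.
From mathcomp Require Import all_boot all_order all_algebra.
From mathcomp Require Import sesquilinear complex.
From mathcomp Require Import all_classical all_reals all_analysis.
Set Implicit Arguments.
Unset Strict Implicit.
Unset Printing Implicit Defensive.
Import Order.TTheory GRing.Theory Num.Theory.
Import numFieldNormedType.Exports.
Local Open Scope classical_set_scope.
Local Open Scope complex_scope.
Local Open Scope ring_scope.

(* In MathComp the norm of a complex vector space takes its values in [R[i]];
   [rnorm] is the same norm read in [R]. *)
Definition rnorm (R : realType) (V : normedModType R[i]) (x : V) : R :=
  complex.Re `|x|.

Definition contfun_pred (R : realType) (X : set R[i]^o) :
    {pred set_type X -> R[i]^o} :=
  [pred f : set_type X -> R[i]^o | `[< continuous f >]].
Arguments contfun_pred {R} X.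

Definition contfun (R : realType) (X : set R[i]^o) : Type :=
  {f : set_type X -> R[i]^o | f \in contfun_pred X}.

Section ContinuousFunctions.
Context (R : realType) (X : set R[i]^o).

Fact contfun_subring_closed : subring_closed (contfun_pred X).
Proof.
split=> [|f g /asboolP cf /asboolP cg|f g /asboolP cf /asboolP cg];
  apply/asboolP => x.
- exact: (@cvg_cst _ (1 : R[i]^o) _ (nbhs x) _).
- exact: (cvgB (cf x) (cg x)).
- exact: (cvgM (cf x) (cg x)).
Qed.

Fact contfun_scaler_closed :
  @GRing.scaler_closed R[i] (set_type X -> R[i]^o) (contfun_pred X).
Proof.
move=> a f /asboolP cf; apply/asboolP => x.
exact: (cvgM (@cvg_cst _ (a : R[i]^o) _ (nbhs x) _) (cf x)).
Qed.

HB.instance Definition _ :=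
  GRing.isSubringClosed.Build _ (contfun_pred X) contfun_subring_closed.
HB.instance Definition _ :=
  GRing.isScaleClosed.Build _ _ (contfun_pred X) contfun_scaler_closed.

HB.instance Definition _ := [isSub of contfun X for sval].
HB.instance Definition _ := [Choice of contfun X by <:].
HB.instance Definition _ :=
  GRing.SubChoice_isSubComPzRing.Build _ _ (contfun X) (subringClosedP _).
HB.instance Definition _ :=
  [SubZmodule_isSubLmodule of contfun X by <:].

Fact conjC_continuous : continuous (Num.conj : R[i]^o -> R[i]^o).
Proof.
move=> z.
apply/(@cvgrPdist_lt R[i] R[i]^o R[i]^o (nbhs z) _ _ (Num.conj z)) => e e0.
have [/(_ cvg_id e e0) zw _] :=
  @cvgrPdist_lt R[i] R[i]^o R[i]^o (nbhs z) _ idfun z.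
by apply: filterS zw => w /=; rewrite -rmorphB norm_conjC.
Qed.

Fact cconj_subproof (f : contfun X) :
  (fun x => Num.conj (val f x)) \in contfun_pred X.
Proof.
have /asboolP cf := valP f; apply/asboolP => x.
by apply: continuous_comp; [exact: cf | exact: conjC_continuous].
Qed.

Definition cconj (f : contfun X) : contfun X := exist _ (fun x => Num.conj (val f x)) (cconj_subproof f).

Fact cincl_subproof : (set_val : set_type X -> R[i]^o) \in contfun_pred X.
Proof. by apply/asboolP; exact: initial_continuous. Qed.

(* The coordinate function z on X. *)
Definition cincl : contfun X := exist _ (set_val : set_type X -> R[i]^o) cincl_subproof.

Definition supnorm (f : contfun X) : R :=
  sup (range (fun x => rnorm (val f x))).

Definition subspace_of (S : set (contfun X)) : Prop :=
  S 0 /\ forall (a : R[i]) f g, S f -> S g -> S (a *: f + g).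

Definition cstar_subalgebra (S : set (contfun X)) : Prop :=
  [/\ subspace_of S,
      forall f g, S f -> S g -> S (f * g),
      forall f, S f -> S (cconj f)
    & forall f, (forall e : R, 0 < e -> exists2 g, S g & supnorm (f - g) < e) ->
        S f].

Definition cstar_generated (G : set (contfun X)) : set (contfun X) :=
  smallest cstar_subalgebra (G `|` [set 1]).

Definition generators (G : set (contfun X)) : Prop :=
  G !=set0 /\ cstar_generated G = setT.

End ContinuousFunctions.

Definition extreme_point (R : realType) (V : lmodType R[i]) (S : set V)
    (x : V) : Prop :=
  S x /\ forall (y z : V) (t : R), S y -> S z -> 0 < t < 1 ->
    x = t%:C *: y + (1 - t)%:C *: z -> y = x /\ z = x.

Section Choquet.
Context (R : realType) (X : set R[i]^o) (M : set (contfun X)).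

(* [set_type M] carries no module structure, so linearity of a functional on M
   is expressed through the operations of C(X). *)
Definition functional_linear (L : set_type M -> R[i]^o) : Prop :=
  forall (a : R[i]) (f g h : set_type M),
    val h = a *: val f + val g -> L h = a * L f + L g.

(* For linear functionals this is continuity. *)
Definition functional_bounded (L : set_type M -> R[i]^o) : Prop :=
  exists k : R, forall f, rnorm (L f) <= k * supnorm (val f).

Definition functional_norm (L : set_type M -> R[i]^o) : R :=
  sup [set rnorm (L f) | f in [set f | supnorm (val f) <= 1]].

Definition state_space : set (set_type M -> R[i]^o) :=
  [set L | [/\ functional_linear L, functional_bounded L,
      forall u, val u = 1 -> L u = 1 & functional_norm L = 1]].

Definition choquet_boundary : set (set_type X) :=
  [set l | extreme_point state_space (fun f => val (val f) l)].

End Choquet.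

(* The inner product is linear in the first argument and conjugate-linear in
   the second one. *)
Record hilbert (R : realType) := Hilbert {
  hilbert_sort :> completeNormedModType R[i];
  inner : {dot hilbert_sort for Num.conj};
  innerE : forall x, inner x x = `|x| ^+ 2
}.
Arguments inner {R h}.

Definition infinite_dimensional (R : realType) (H : hilbert R) : Prop :=
  ~ exists (n : nat) (e : 'I_n -> H),
      forall x : H, exists c : 'I_n -> R[i], x = \sum_i c i *: e i.

Definition bop_pred (R : realType) (H : hilbert R) : {pred H -> H} :=
  [pred A : H -> H | `[< linear A /\
     exists k : R, forall x, `|A x| <= k%:C * `|x| >]].
Arguments bop_pred {R} H.

Definition bop (R : realType) (H : hilbert R) : Type :=
  {A : H -> H | A \in bop_pred H}.

Section BoundedOperators.
Context (R : realType) (H : hilbert R).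

Fact bop_submod_closed :
  @GRing.submod_closed R[i] (H -> H) (bop_pred H).
Proof.
split=> [|a A B /asboolP[lA [k kA]] /asboolP[lB [l lB']]]; apply/asboolP.
  split=> [b x y|]; first by rewrite scaler0 addr0.
  by exists 0 => x; rewrite normr0 mul0r.
split=> [b x y|].
  rewrite !fctE lA lB !scalerDr !scalerA (mulrC a b) !addrA.
  by congr (_ + _); rewrite -!addrA; congr (_ + _); rewrite addrC.
exists (rnorm (a : R[i]^o) * k + l) => x.
rewrite rmorphD rmorphM /= mulrDl; apply: le_trans (ler_normD _ _) _.
apply: lerD (lB' x); rewrite normrZ -mulrA.
have -> : (rnorm (a : R[i]^o))%:C = `|a|.
  by rewrite /rnorm RRe_real // normr_real.
by rewrite ler_wpM2l.
Qed.

HB.instance Definition _ :=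
  GRing.isSubmodClosed.Build _ _ (bop_pred H) bop_submod_closed.
HB.instance Definition _ := [isSub of bop H for sval].
HB.instance Definition _ := [Choice of bop H by <:].
HB.instance Definition _ := [SubChoice_isSubLmodule of bop H by <:].

Fact bop1_subproof : idfun \in bop_pred H.
Proof.
by apply/asboolP; split=> // ; exists 1 => x; rewrite mul1r.
Qed.

Fact bopM_subproof (A B : bop H) : val A \o val B \in bop_pred H.
Proof.
have /asboolP[lA [k kA]] := valP A; have /asboolP[lB [l lB']] := valP B.
apply/asboolP; split=> [a x y|]; first by rewrite /= lB lA.
exists (`|k| * l) => x; rewrite rmorphM /= -mulrA.
apply: (le_trans (kA _)).
apply: (@le_trans _ _ ((`|k|)%:C * `|val B x|)).
  by rewrite ler_wpM2r // lecR ler_norm.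
by rewrite ler_wpM2l // ler0c.
Qed.

Definition bop1 : bop H := exist _ idfun bop1_subproof.
Definition bopM (A B : bop H) : bop H := exist _ (val A \o val B) (bopM_subproof A B).

Fact bopMA : associative bopM.
Proof. by move=> A B C; apply: val_inj. Qed.
Fact bop1M : left_id bop1 bopM.
Proof. by move=> A; apply: val_inj. Qed.
Fact bopM1 : right_id bop1 bopM.
Proof. by move=> A; apply: val_inj. Qed.
Fact bopMDl : left_distributive bopM +%R.
Proof. by move=> A B C; apply: val_inj. Qed.
Fact bopMDr : right_distributive bopM +%R.
Proof.
move=> A B C; apply: val_inj; apply/funext => x /=.
have /asboolP[lA _] := valP A.
by have := lA 1 (val B x) (val C x); rewrite !scale1r.
Qed.

HB.instance Definition _ :=
  GRing.Zmodule_isPzRing.Build (bop H) bopMA bop1M bopM1 bopMDl bopMDr.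

Definition opnorm (A : bop H) : R :=
  sup [set rnorm (val A x) | x in [set x : H | `|x| <= 1]].

Definition is_adjoint (A B : bop H) : Prop :=
  forall x y, inner (val A x) y = inner x (val B y).

(* The adjoint is given as a relation; by the Riesz representation theorem every
   operator has exactly one. *)
Definition normal_op (A : bop H) : Prop :=
  exists B, is_adjoint A B /\ A * B = B * A.

Definition invertible_op (A : bop H) : Prop :=
  exists B, A * B = 1 /\ B * A = 1.

Definition spectrum (A : bop H) : set R[i]^o :=
  [set l | ~ invertible_op (A - (l : R[i]) *: (1 : bop H))].

Definition sot_cvg (T : nat -> bop H) (S : bop H) : Prop :=
  forall x, (fun n => val (T n) x) @ \oo --> val S x.

Definition wot_cvg (T : nat -> bop H) (S : bop H) : Prop :=
  forall x y,
    (fun n => inner (val (T n) x) y : R[i]^o) @ \oo --> (inner (val S x) y : R[i]^o).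

(* Positivity of an operator matrix acting on the direct sum of n copies
   of H. *)
Definition positive_opmx (n : nat) (A : 'M[bop H]_n) : Prop :=
  forall x : 'I_n -> H, 0 <= \sum_i \sum_j inner (val (A i j) (x j)) (x i).

Definition ucp (Phi : {linear bop H -> bop H}) : Prop :=
  Phi 1 = 1 /\
  forall n (A : 'M[bop H]_n), positive_opmx A -> positive_opmx (map_mx Phi A).

End BoundedOperators.

Section Representations.
Context (R : realType) (X : set R[i]^o).

Definition representation (H : hilbert R) (pi : contfun X -> bop H) : Prop :=
  [/\ linear pi, pi 1 = 1, forall f g, pi (f * g) = pi f * pi g
    & forall f, is_adjoint (pi f) (pi (cconj f))].

(* f(A) for a normal operator A with spectrum contained in X: the value at f of
   the unique unital *-homomorphism C(X) -> B(H) that maps the coordinate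
   function to A. For other A there is no such homomorphism, and [fcalc A f] is
   a junk value. *)
Definition fcalc (H : hilbert R) (A : bop H) : contfun X -> bop H :=
  xget (fun=> 0) [set pi | representation pi /\ pi (cincl X) = A].

Definition hyperrigid (G : set (contfun X)) : Prop :=
  G !=set0 /\
  forall (H : hilbert R) (pi : contfun X -> bop H),
    representation pi -> injective pi ->
    forall Phi : nat -> {linear bop H -> bop H},
      (forall k, ucp (Phi k)) ->
      (forall g, G g -> opnorm (Phi k (pi g) - pi g) @[k --> \oo] --> 0) ->
      forall f, opnorm (Phi k (pi f) - pi f) @[k --> \oo] --> 0.

End Representations.

(* Main.v *)
(* Since [X] is not its own Choquet boundary, some evaluation at a point [l] is a
   proper convex combination of states of [M]; extending these states by
   Hahn-Banach gives a state [phi] of C(X) that agrees with the evaluation at [l]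
   on [M] but is positive on [|z - l|^2].  Partitions of unity approximate [phi]
   by finitely supported measures [sum_k w_k delta_(p_k)].  A reflection sends the
   unit vector [sum_k sqrt(w_k) g_k], for fresh orthonormal vectors [g_k], to a
   fixed unit vector [e0].  The normal operator with eigenvalue [p_k] on the
   reflected vector [g_k], and [l] on the complement, then has [f(T_n)]
   compressing on [e0] to the approximating measure of [f], while the [g_k] drift
   weakly to 0.  So [f(T_n)] tends weakly to [f(l)] off [e0] and to [phi f] on
   [e0], and [T] is the scalar [l].
   A hyperrigid set [G] on which [phi] agrees with the evaluation at [l] would
   force [phi] to be that evaluation: test it on the maps
   [A |-> (1 - Q) A (1 - Q) + (sum_k w_k <A g_k, g_k>) Q], where [Q] projects onto
   [e0], and on a diagonal representation with eigenvalue [l] on [e0] and [p_k] on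
   [g_k]. *)
From HB Require Import structures.
Require Import Defs.
From mathcomp Require Import all_boot all_order all_algebra.
From mathcomp Require Import sesquilinear complex.
From mathcomp Require Import all_classical all_reals all_analysis.
From mathcomp Require Import ring lra.
Set Implicit Arguments.
Unset Strict Implicit.
Unset Printing Implicit Defensive.
Import Order.TTheory GRing.Theory Num.Theory.
Import numFieldNormedType.Exports.
Local Open Scope classical_set_scope.
Local Open Scope complex_scope.
Local Open Scope ring_scope.

(** * Continuous functions on a compact subset of the plane *)

Section Modulus.
Context (R : realType).
Implicit Types (z w : R[i]) (r : R).

(** The [T_n] must be normal on the given space, so the measures cannot be dilated to a larger one;
    infinite dimension supplies the room inside [H]. Finitely supported measures make each [T_n] a
    finite-rank perturbation of the scalar [l], which reduces the estimates to finite sums and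
    Bessel's inequality. Keeping the vectors for different [n] mutually orthogonal serves twice: it
    yields the weak decay, and it lets a single representation carry every approximating measure,
    faithfully because the support points are dense in [X]. The decisive quantity is the value of
    [phi] at [|z - l|^2]. It is the limit of [|(T_n - l) e0|^2], so its positivity excludes strong
    convergence, and it separates [phi] from the evaluation at [l], against hyperrigidity.
    Positivity rests on a Korovkin estimate: a state vanishing at [|z - l|^2] is the evaluation at
    [l]. States are handled through their real parts, since domination in the Hahn-Banach theorem is
    a real statement. As [fcalc] is defined by choice, it can be computed only after showing that
    the image of [z] determines the representation; for diagonal operators this is read off on
    eigenvectors. *)

Definition cabs z : R := complex.Re `|z|.

Lemma normE_cabs z : `|z| = (cabs z)%:C.
Proof. by rewrite /cabs RRe_real // normr_real. Qed.

Lemma cabs_ge0 z : 0 <= cabs z.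
Proof. by rewrite -ler0c -normE_cabs. Qed.

Lemma cabsM z w : cabs (z * w) = cabs z * cabs w.
Proof. by apply: complexI; rewrite rmorphM /= -!normE_cabs normrM. Qed.

Lemma cabsN z : cabs (- z) = cabs z.
Proof. by rewrite /cabs normrN. Qed.

Lemma cabs_sym z w : cabs (z - w) = cabs (w - z).
Proof. by rewrite /cabs distrC. Qed.

Lemma cabsR r : cabs r%:C = `|r|.
Proof. by rewrite /cabs normc_def /= expr0n addr0 sqrtr_sqr. Qed.

Lemma cabs0 : cabs 0 = 0.
Proof. by rewrite /cabs normr0. Qed.

Lemma cabs1 : cabs 1 = 1.
Proof. by rewrite /cabs normr1. Qed.

Lemma cabs_eq0 z : cabs z = 0 -> z = 0.
Proof. by move=> z0; apply/normr0_eq0; rewrite normE_cabs z0. Qed.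

Lemma cabsD z w : cabs (z + w) <= cabs z + cabs w.
Proof. by rewrite -lecR rmorphD /= -!normE_cabs ler_normD. Qed.

Lemma cabsB_le z w : cabs (z - w) <= cabs z + cabs w.
Proof. by rewrite -(cabsN w); exact: cabsD. Qed.

Lemma cabs_dist z w : `|cabs z - cabs w| <= cabs (z - w).
Proof.
rewrite ler_norml; have := cabsD (z - w) w; have := cabsD (w - z) z.
by rewrite !subrK (cabs_sym w); lra.
Qed.

Lemma conjCE z : Num.conj z = conjc z.
Proof.
have [->|z0] := eqVneq z 0; first by rewrite conjC0 conjc0.
by apply: (mulfI z0); rewrite -normCK sqr_normc.
Qed.

Lemma conjC_real r : Num.conj r%:C = r%:C :> R[i].
Proof. by rewrite conjCE conjc_real. Qed.

Lemma mul_conjC z : z * Num.conj z = (cabs z ^+ 2)%:C.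
Proof. by rewrite -normCK normE_cabs rmorphXn. Qed.

Lemma sqr_cabs z : cabs z ^+ 2 = complex.Re z ^+ 2 + complex.Im z ^+ 2.
Proof. by apply: complexI; rewrite rmorphXn /= -normE_cabs -add_Re2_Im2. Qed.

Lemma Re_le_cabs z : `|complex.Re z| <= cabs z.
Proof.
rewrite -(@ler_pXn2r _ 2) // ?nnegrE ?normr_ge0 ?cabs_ge0 //.
by rewrite real_normK ?num_real // sqr_cabs lerDl sqr_ge0.
Qed.

Lemma ReD z w : complex.Re (z + w) = complex.Re z + complex.Re w.
Proof. by case: z; case: w. Qed.

Lemma ReRM r z : complex.Re (r%:C * z) = r * complex.Re z.
Proof. by case: z => a b /=; rewrite mul0r subr0. Qed.

Lemma ReMi z : complex.Re ('i * z) = - complex.Im z.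
Proof. by case: z => a b /=; rewrite mul0r mul1r sub0r. Qed.

Lemma complex_gt0P z : 0 < z -> exists2 r, 0 < r & z = r%:C.
Proof.
move=> z0; exists (complex.Re z); last by rewrite RRe_real // ger0_real ?ltW.
by move: z0; rewrite ltcE => /andP[].
Qed.

(** Neighbourhoods in [R[i]^o] have radii in [R[i]]; the real form makes the order and limit lemmas
    of [R] available. *)
Lemma cvgC_cabs (T : Type) (F : set_system T) (FF : Filter F) (f : T -> R[i]^o) (l : R[i]) :
  (f @ F --> (l : R[i]^o)) <-> (cabs (f x - l) @[x --> F] --> (0 : R)).
Proof.
split=> [/cvgrPdist_lt fl|/cvgrPdist_lt fl]; apply/cvgrPdist_lt => e e0.
  have : 0 < e%:C by rewrite ltcR.
  move=> /fl; apply: filterS => x /=.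
  rewrite (_ : `|_|%R = `|l - (f x : R[i])|) // normE_cabs ltcR => lt.
  by rewrite sub0r normrN ger0_norm ?cabs_ge0 // cabs_sym.
have [r r0 ->] := complex_gt0P e0.
move: (fl _ r0); apply: filterS => x /=.
rewrite sub0r normrN ger0_norm ?cabs_ge0 // => lt.
by rewrite (_ : `|_|%R = `|l - (f x : R[i])|) // normE_cabs ltcR cabs_sym.
Qed.

Lemma ballC_cabs z w r : ball (z : R[i]^o) r%:C (w : R[i]^o) <-> cabs (w - z) < r.
Proof. by rewrite -ball_normE /= cabs_sym -ltcR -normE_cabs. Qed.

End Modulus.

Section ContinuousFunctions.
Context (R : realType) (X : set R[i]^o).
Implicit Types (f g : contfun X) (x y : set_type X).

(* The values of a continuous function and the points of X, read in the field
   [R[i]] rather than in the normed space [R[i]^o]. *)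
Definition ev f x : R[i] := val f x.
Definition pt x : R[i] := val x.

Lemma open_ballC (z : R[i]^o) (V : set R[i]^o) : open V -> V z ->
  exists2 r : R, 0 < r & forall w, cabs ((w : R[i]) - z) < r -> V w.
Proof.
move=> oV Vz; have : nbhs z V by apply: open_nbhs_nbhs; split.
case/nbhs_ballP => e /= /complex_gt0P[r r0 ->] rV.
by exists r => // w wz; apply: rV; exact/ballC_cabs.
Qed.

Lemma nbhs_ballC (z : R[i]^o) (r : R) : 0 < r -> nbhs z (ball z r%:C).
Proof. by move=> r0; apply: nbhsx_ballx; rewrite ltcR. Qed.

Lemma nbhs_preimage_set_val x (V : set R[i]^o) :
  nbhs (val x : R[i]^o) V -> nbhs x (set_val @^-1` V).
Proof. exact: (@initial_continuous _ _ (set_val : set_type X -> R[i]^o) x _). Qed.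

Lemma nbhs_set_typeP x (U : set (set_type X)) :
  nbhs x U <-> exists2 d : R, 0 < d &
    forall y, cabs (pt y - pt x) < d -> U y.
Proof.
split.
  case=> B /= [] [V oV VB] Bx BU.
  have [|r r0 rV] := open_ballC oV (z := val x); first by rewrite -VB in Bx.
  by exists r => // y yx; apply: BU; rewrite -VB; apply: rV.
case=> d d0 dU.
have nb := nbhs_preimage_set_val (nbhs_ballC (val x) d0).
by apply: (@filterS _ (nbhs x) _ _ _ _ nb) => y /ballC_cabs; exact: dU.
Qed.

(** The topology of [set_type X] is induced by the inclusion into the plane, so its neighbourhoods
    are traces of discs. *)
Lemma contfun_predP (f : set_type X -> R[i]^o) :
  f \in contfun_pred X <-> forall x (e : R), 0 < e -> exists2 d : R, 0 < d &
    forall y, cabs (pt y - pt x) < d -> cabs ((f y : R[i]) - f x) < e.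
Proof.
split=> [/asboolP cf x e e0|cf].
  have FF : Filter (nbhs x) := nbhs_filter x.
  have /(cvgC_cabs FF)/cvgrPdist_lt/(_ _ e0) := cf x.
  move=> H; apply/nbhs_set_typeP; move: H.
  apply: filterS => y /=; by rewrite sub0r normrN ger0_norm ?cabs_ge0.
apply/asboolP => x; have FF : Filter (nbhs x) := nbhs_filter x.
apply/(cvgC_cabs FF)/cvgrPdist_lt => e e0.
apply: (@filterS _ (nbhs x) _ _ _ _ (_ : nbhs x [set y | cabs ((f y : R[i]) - f x) < e])) => [y /=|].
  by rewrite sub0r normrN ger0_norm ?cabs_ge0.
exact/nbhs_set_typeP/cf.
Qed.

Lemma contfun_cvg f x (e : R) : 0 < e -> exists2 d : R, 0 < d &
  forall y, cabs (pt y - pt x) < d ->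
    cabs (ev f y - ev f x) < e.
Proof. by have /contfun_predP := valP f; apply. Qed.

Lemma contfunD f g x : ev (f + g) x = ev f x + ev g x.
Proof. by []. Qed.
Lemma contfunN f x : ev (- f) x = - ev f x.
Proof. by []. Qed.
Lemma contfunM f g x : ev (f * g) x = ev f x * ev g x.
Proof. by []. Qed.
Lemma contfunZ (a : R[i]) f x : ev (a *: f) x = a * ev f x.
Proof. by []. Qed.
Lemma contfun1 x : ev (1 : contfun X) x = 1.
Proof. by []. Qed.

Lemma contfun_sum (I : Type) (s : seq I) (P : pred I) (F : I -> contfun X) x :
  ev (\sum_(i <- s | P i) F i) x = \sum_(i <- s | P i) ev (F i) x.
Proof.
elim: s => [|i s ih]; rewrite ?big_nil ?big_cons //.
by case: (P i); rewrite ?contfunD ih.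
Qed.

Lemma contfunP f g : (forall x, ev f x = ev g x) -> f = g.
Proof. by move=> fg; apply/val_inj/funext. Qed.

Section Compact.
Hypothesis cX : compact X.

Lemma contfun_unif f (e : R) : 0 < e -> exists2 d : R, 0 < d &
  forall x y, cabs (pt y - pt x) < d ->
    cabs (ev f y - ev f x) < e.
Proof.
move=> e0.
pose P (d : R) (z : R[i]^o) := forall x y : set_type X, pt x = z ->
  cabs (pt y - pt x) < d -> cabs (ev f y - ev f x) < e.
(* Compactness in near-covering form: it suffices to find, around each point, a disc on which all
   small radii work. Half of the local [d] goes to the disc, half to the radius. *)
have near_P : \forall d \near (0 : R)^'+, X `<=` P d.
  move/compact_near_coveringP : cX => /(_ _ (0 : R)^'+ P); apply=> z Xz.
  pose x0 : set_type X := SigSub (mem_set Xz).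
  have e20 : 0 < e / 2 by lra.
  have [d d0 dP] := contfun_cvg f x0 e20.
  exists (ball (z : R[i]^o) (d / 2)%:C, [set r | 0 < r < d / 2]) => /=.
    split; first by apply: nbhsx_ballx; rewrite ltcR; lra.
    by near=> r; apply/andP; split; near: r;
      [exact: nbhs_right_gt|apply: nbhs_right_lt; lra].
  case=> z' r /= [zz' /andP[r0 rd]] x y xz' yx.
  move: zz' => /ballC_cabs zz'.
  have xx0 : cabs (pt x - pt x0) < d.
    by rewrite xz'; apply: lt_le_trans zz' _; lra.
  have yx0 : cabs (pt y - pt x0) < d.
    rewrite -(subrKA (pt x)); apply: le_lt_trans (cabsD _ _) _.
    by rewrite xz' in yx *; move: yx zz'; rewrite /pt /=; lra.
  rewrite -(subrKA (ev f x0)); apply: le_lt_trans (cabsD _ _) _.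
  have := dP _ xx0; have := dP _ yx0; rewrite (cabs_sym (ev f x0)); lra.
near (0 : R)^'+ => d.
exists d; first by near: d; exact: nbhs_right_gt.
move=> x y yx.
have Pd : X `<=` P d by near: d.
by apply: (Pd (val x)) => //; have := valP x; rewrite inE.
Unshelve. all: by end_near.
Qed.

Lemma compact_net (e : R) : 0 < e ->
  exists s : seq (set_type X), forall x, exists2 y, y \in s & cabs (pt x - pt y) < e.
Proof.
move=> e0; have := cX; rewrite compact_cover.
case/(_ R[i]^o X (fun z => (ball (z : R[i]^o) e%:C)°)) => [z _|z Xz|D' D'X XD'].
- exact: open_interior.
- by exists z => //; apply: nbhsx_ballx; rewrite ltcR.
exists (pmap insub (finmap.enum_fset D')) => x.
have Xx : X (val x) by have := valP x; rewrite inE.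
have [z /= zD' /interior_subset zx] := XD' _ Xx.
have zX : z \in X by apply: D'X.
exists (SigSub zX); first by rewrite mem_pmap_sub.
by move: zx => /ballC_cabs.
Qed.

Lemma contfun_bounded f : exists2 B : R, 0 <= B & forall x, cabs (ev f x) <= B.
Proof.
have [d d0 fd] := contfun_unif f (ltr01 : 0 < 1 :> R).
have [s sX] := compact_net d0.
have ge0 y : 0 <= cabs (ev f y) := cabs_ge0 _.
exists (1 + \sum_(y <- s) cabs (ev f y)).
  by apply: addr_ge0 => //; apply: sumr_ge0.
move=> x; have [y ys xy] := sX x.
rewrite -[ev f x](subrK (ev f y)).
apply: le_trans (cabsD _ _) _; apply: lerD; first exact/ltW/fd.
by rewrite (big_rem y ys) /= lerDl sumr_ge0.
Qed.

Lemma cabs_le_supnorm f x : cabs (ev f x) <= supnorm f.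
Proof.
have [B _ fB] := contfun_bounded f.
have ub : has_ubound (range (fun y => rnorm (val f y))).
  by exists B => _ [y _ <-]; exact: fB.
by apply: (ub_le_sup ub); exists x.
Qed.

End Compact.

Lemma supnorm_le f (B : R) : X !=set0 -> (forall x, cabs (ev f x) <= B) -> supnorm f <= B.
Proof.
case=> z Xz fB; rewrite /supnorm; apply: ge_sup; last by move=> _ [y _ <-]; exact: fB.
by exists (rnorm (val f (SigSub (mem_set Xz)))), (SigSub (mem_set Xz)).
Qed.

End ContinuousFunctions.

(** * The Hahn-Banach theorem *)

Section HahnBanach.
Context (R : realType) (V : lmodType R[i]).
Implicit Types (p q : V -> R) (x y : V) (r t : R).

(** The complex space is treated as a real one: only positive real scalars occur. *)
Definition sublinear q :=
  (forall x y, q (x + y) <= q x + q y) /\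
  forall r x, 0 < r -> q (r%:C *: x) = r * q x.

Lemma sublinear0 q : sublinear q -> q 0 = 0.
Proof.
by case=> _ qZ; have := qZ 2 0 (ltr0Sn R 1); rewrite scaler0; lra.
Qed.

Lemma sublinearN q x : sublinear q -> - q (- x) <= q x.
Proof.
move=> sq; have := sq.1 x (- x); rewrite subrr sublinear0 //; lra.
Qed.

(** The common pattern of three constructions below: the infimum of a chain, the infimum over
    translates along one vector, and the infimum over a subspace. [lb] keeps the infimum finite.
    Homogeneity needs only one inequality, since the other follows by using [r^-1]. *)
Lemma infimum_sublinear (I : Type) (i0 : I) (F : I -> V -> R) (lb : V -> R) :
  (forall i x, lb x <= F i x) ->
  (forall i j x y, exists k, F k (x + y) <= F i x + F j y) ->
  (forall r i x, 0 < r -> exists k, F k (r%:C *: x) <= r * F i x) ->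
  exists q, [/\ sublinear q, forall i x, q x <= F i x
    & forall x b, (forall i, b <= F i x) -> b <= q x].
Proof.
move=> lbF FD FZ; pose q x := inf (range (F^~ x)).
have qF i x : q x <= F i x.
  have hl : has_lbound (range (F^~ x)) by exists (lb x) => _ [j _ <-].
  by apply: (ge_inf hl); exists i.
have qle x b : (forall i, b <= F i x) -> b <= q x.
  move=> bF; apply: lb_le_inf; first by exists (F i0 x), i0.
  by move=> _ [i _ <-].
have qZ r x : 0 < r -> r * q x <= q (r%:C *: x).
  move=> r0; apply: (qle _ _) => i.
  have ri0 : 0 < r^-1 by rewrite invr_gt0.
  have [k] := FZ r^-1 i (r%:C *: x) ri0.
  rewrite scalerA -rmorphM /= mulVf ?gt_eqF // scale1r => Fk.
  by rewrite -ler_pdivlMl //; apply: le_trans Fk.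
exists q; split=> //; split=> [x y|r x r0].
  have : q (x + y) - q y <= q x.
    apply: (qle _ _) => i; suff : q (x + y) - F i x <= q y by lra.
    apply: qle => j; have [k Fk] := FD i j x y.
    by have := qF k (x + y); lra.
  by lra.
apply/eqP; rewrite eq_le qZ // andbT.
have ri0 : 0 < r^-1 by rewrite invr_gt0.
have := qZ r^-1 (r%:C *: x) ri0.
by rewrite scalerA -rmorphM /= mulVf ?gt_eqF // scale1r ler_pdivrMl.
Qed.

(** Zorn's lemma for the reversed pointwise order. The infimum of a nonempty chain is finite because
    every sublinear functional below [p] is at least [- p (- x)]; the empty chain is bounded by [p]
    itself. *)
Lemma minimal_sublinear p : sublinear p ->
  exists q, [/\ sublinear q, forall x, q x <= p x
    & forall q', sublinear q' -> (forall x, q' x <= q x) -> q' = q].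
Proof.
move=> sp; pose T := {q | sublinear q /\ forall x, q x <= p x}.
pose below (a b : T) := `[< forall x, sval b x <= sval a x >].
have [||a b /asboolP ab /asboolP ba|A Atot|[q [sq qp]] qmin] := @Zorn T below.
- by move=> a; apply/asboolP.
- move=> b a c /asboolP ab /asboolP bc; apply/asboolP => x.
  exact: le_trans (bc x) (ab x).
- apply: eq_sig_hprop => [q ? ?|]; first exact: Prop_irrelevance.
  by apply/funext => x; apply/eqP; rewrite eq_le ab ba.
- have [[a Aa]|A0] := pselect (A !=set0); last first.
    have pp : sublinear p /\ forall x, p x <= p x by [].
    by exists (exist _ p pp) => b Ab; case: A0; exists b.
  have [q [sq qF _]] : exists q, [/\ sublinear q,
      forall (i : {b | A b}) x, q x <= sval (sval i) x
    & forall x b, (forall i : {b | A b}, b <= sval (sval i) x) -> b <= q x].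
    apply: (@infimum_sublinear _ (exist _ a Aa) _ (fun x => - p (- x))).
    + move=> [[q [sq qp]] Aq] x /=; apply: le_trans (sublinearN x sq).
      by rewrite lerN2.
    + move=> [b Ab] [c Ac] x y /=.
      have [/asboolP bc|/asboolP cb] := Atot _ _ Ab Ac.
        exists (exist _ c Ac) => /=; apply: le_trans ((svalP c).1.1 _ _) _.
        by rewrite lerD2r.
      exists (exist _ b Ab) => /=; apply: le_trans ((svalP b).1.1 _ _) _.
      by rewrite lerD2l.
    + by move=> r [b Ab] x r0; exists (exist _ b Ab) => /=; rewrite (svalP b).1.2.
  have qp x : q x <= p x.
    exact: le_trans (qF (exist _ a Aa) x) ((svalP a).2 x).
  exists (exist _ q (conj sq qp)) => b Ab; apply/asboolP => x /=.
  exact: qF (exist _ b Ab) x.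
- exists q; split=> // q' sq' q'q.
  have q'p x : q' x <= p x by exact: le_trans (q'q x) (qp x).
  have /(congr1 sval) := qmin (exist _ q' (conj sq' q'p)) (introT (asboolP _) q'q).
  by [].
Qed.

(* For fixed v, [inf_(t >= 0) q (x + t v) - t q v] is again sublinear and below
   q, so minimality gives [q (x + v) = q x + q v]. *)
Lemma minimal_sublinear_linear q : sublinear q ->
  (forall q', sublinear q' -> (forall x, q' x <= q x) -> q' = q) ->
  (forall x y, q (x + y) = q x + q y) /\ forall r x, q (r%:C *: x) = r * q x.
Proof.
move=> sq qmin; have q0 := sublinear0 sq; have [qD qZ] := sq.
have qZ0 r x : 0 <= r -> q (r%:C *: x) = r * q x.
  rewrite le_eqVlt => /predU1P[<-|]; last exact: qZ.
  by rewrite scale0r mul0r.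
have add x v : q (x + v) = q x + q v.
  apply/eqP; rewrite eq_le qD /=.
  have [q' [sq' q'F _]] : exists q', [/\ sublinear q',
      forall (t : {t : R | 0 <= t}) x, q' x <= q (x + (sval t)%:C *: v) - sval t * q v
    & forall x b, (forall t : {t : R | 0 <= t}, b <= q (x + (sval t)%:C *: v) - sval t * q v) ->
       b <= q' x].
    apply: (@infimum_sublinear _ (exist _ 0 (lexx 0)) _ (fun x => - q (- x))).
    - move=> [t t0] y /=; have := qD (y + t%:C *: v) (- y).
      by rewrite addrAC subrr add0r qZ0 //; lra.
    - move=> [s s0] [t t0] y z /=; exists (exist _ (s + t) (addr_ge0 s0 t0)) => /=.
      rewrite rmorphD /= scalerDl addrACA.
      by have := qD (y + s%:C *: v) (z + t%:C *: v); lra.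
    - move=> r [t t0] y r0; have rt0 : 0 <= r * t by rewrite mulr_ge0 // ltW.
      exists (exist _ (r * t) rt0) => /=.
      by rewrite rmorphM /= -scalerA -scalerDr qZ // mulrBr mulrA.
  have q'q : q' = q.
    apply: qmin => // y; have := q'F (exist _ 0 (lexx 0)) y.
    by rewrite /= scale0r addr0 mul0r subr0.
  have := q'F (exist _ 1 ler01) x; rewrite /= q'q scale1r mul1r; lra.
split=> // r x; have [r0|r0] := leP 0 r; first exact: qZ0.
have := add (r%:C *: x) ((- r)%:C *: x).
have nr0 : 0 < - r by rewrite oppr_gt0.
rewrite -scalerDl -rmorphD subrr /= scale0r q0 (qZ _ _ nr0) mulNr; lra.
Qed.

(** The infimum over [m] in [M] of [p (x - m) + L m] is sublinear, lies below [p], and is at most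
    [L] on [M]. A minimal sublinear functional under it is linear, and being at most [L] at both [x]
    and [- x] it equals [L] on [M]. *)
Theorem hahn_banach p (M : set V) (L : V -> R) : sublinear p ->
  M 0 -> (forall x y, M x -> M y -> M (x + y)) ->
  (forall r x, M x -> M (r%:C *: x)) ->
  (forall x y, M x -> M y -> L (x + y) = L x + L y) ->
  (forall r x, M x -> L (r%:C *: x) = r * L x) ->
  (forall x, M x -> L x <= p x) ->
  exists psi : V -> R, [/\ forall x y, psi (x + y) = psi x + psi y,
    forall r x, psi (r%:C *: x) = r * psi x, forall x, psi x <= p x
    & forall x, M x -> psi x = L x].
Proof.
move=> sp M0 MD MZ LD LZ Lp; have [pD pZ] := sp.
have MN x : M x -> M (- x) by move=> /(MZ (- 1)); rewrite rmorphN scaleN1r.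
have LN x : M x -> L (- x) = - L x.
  by move=> /(LZ (- 1)); rewrite rmorphN scaleN1r mulN1r.
have [q [sq qF _]] : exists q, [/\ sublinear q,
      forall (m : {m | M m}) x, q x <= p (x - sval m) + L (sval m)
    & forall x b, (forall m : {m | M m}, b <= p (x - sval m) + L (sval m)) -> b <= q x].
  apply: (@infimum_sublinear _ (exist _ 0 M0) _ (fun x => - p (- x))).
  - move=> [m Mm] x /=; have := pD (x - m) (- x).
    rewrite addrAC subrr add0r.
    by have := Lp _ (MN _ Mm); rewrite LN //; lra.
  - move=> [m Mm] [n Mn] x y /=; exists (exist _ _ (MD _ _ Mm Mn)) => /=.
    by rewrite LD // opprD addrACA; have := pD (x - m) (y - n); lra.
  - move=> r [m Mm] x r0; exists (exist _ _ (MZ r _ Mm)) => /=.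
    by rewrite LZ // -scalerBr pZ // mulrDr.
have [psi [spsi psiq psimin]] := minimal_sublinear sq.
have [psiD psiZ] := minimal_sublinear_linear spsi psimin.
exists psi; split=> // [x|x Mx].
  apply: le_trans (psiq x) _; have := qF (exist _ 0 M0) x.
  by rewrite /= subr0; have := LZ 0 0 M0; rewrite scale0r mul0r => ->; rewrite addr0.
have le y : M y -> psi y <= L y.
  move=> My; apply: le_trans (psiq y) _; have := qF (exist _ y My) y.
  by rewrite /= subrr sublinear0 // add0r.
apply/eqP; rewrite eq_le le //=.
have := le _ (MN _ Mx); have := psiZ (- 1) x.
by rewrite rmorphN scaleN1r mulN1r LN // => ->; rewrite lerN2.
Qed.

End HahnBanach.

(** * States of C(X) and discrete measures *)

Section ContinuousConstructions.
Context (R : realType) (X : set R[i]^o).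
Implicit Types (f g : contfun X) (x y : set_type X).

Definition continuousC (phi : R[i] -> R) := forall z (e : R), 0 < e ->
  exists2 d : R, 0 < d & forall w, cabs (w - z) < d -> `|phi w - phi z| < e.

Lemma contfun_comp_subproof (phi : R[i] -> R) f : continuousC phi ->
  (fun x => (phi (ev f x))%:C : R[i]^o) \in contfun_pred X.
Proof.
move=> cphi; apply/contfun_predP => x e e0.
have [d d0 dphi] := cphi (ev f x) e e0.
have [c c0 cf] := contfun_cvg f x d0.
by exists c => // y /cf /dphi; rewrite -rmorphB /= cabsR.
Qed.

Definition contfun_comp (phi : R[i] -> R) f (cphi : continuousC phi) : contfun X :=
  exist _ (fun x => (phi (ev f x))%:C : R[i]^o) (contfun_comp_subproof f cphi).

Lemma ev_comp phi f (cphi : continuousC phi) x :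
  ev (contfun_comp f cphi) x = (phi (ev f x))%:C.
Proof. by []. Qed.

Lemma contfunV_subproof f : (forall x, ev f x != 0) ->
  (fun x => (val f x)^-1 : R[i]^o) \in contfun_pred X.
Proof.
move=> f0; have /asboolP cf := valP f; apply/asboolP => x.
have FF : Filter (nbhs x) := nbhs_filter x.
exact: (@cvgV _ _ _ _ _ _ (f0 x) (cf x)).
Qed.

Definition contfunV f (f0 : forall x, ev f x != 0) : contfun X :=
  exist _ (fun x => (val f x)^-1 : R[i]^o) (contfunV_subproof f0).

Lemma ev_inv f (f0 : forall x, ev f x != 0) x : ev (contfunV f0) x = (ev f x)^-1.
Proof. by []. Qed.

Lemma ev_conj f x : ev (cconj f) x = Num.conj (ev f x).
Proof. by []. Qed.

Lemma ev_cincl x : ev (cincl X) x = pt x.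
Proof. by []. Qed.

Lemma continuousC_sqrt : continuousC (fun z => Num.sqrt (complex.Re z)).
Proof.
move=> z e e0.
have /cvgrPdist_lt/(_ _ e0)/nbhs_ballP[d /= d0 dP] := @sqrt_continuous R (complex.Re z).
exists d => // w wz; rewrite distrC; apply: dP; rewrite /ball /= distrC.
apply: le_lt_trans wz; apply: le_trans _ (Re_le_cabs _).
by case: w => ? ?; case: z => ? ?.
Qed.

Definition csqrt f := contfun_comp f continuousC_sqrt.

Lemma csqrtK f : (forall x, 0 <= ev f x) -> csqrt f * csqrt f = f.
Proof.
move=> f0; apply: contfunP => x; rewrite contfunM ev_comp -rmorphM /= -expr2.
have := f0 x; rewrite lecE /= => /andP[/eqP im0 re0].
by rewrite sqr_sqrtr //; case: (ev f x) im0 => a b /= ->.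
Qed.

Lemma cconj_csqrt f : cconj (csqrt f) = csqrt f.
Proof. by apply: contfunP => x; rewrite ev_conj ev_comp conjC_real. Qed.

Lemma continuousC_bump (c : R[i]) (r : R) :
  continuousC (fun z => Num.max 0 (r - cabs (z - c))).
Proof.
move=> z e e0; exists e => // w wz.
have := cabs_dist (w - c) (z - c).
rewrite opprB addrA subrK => wz'; rewrite ltr_norml.
move: wz'; rewrite ler_norml => /andP[h1 h2].
by rewrite /Num.max; case: ifPn; case: ifPn; rewrite -?leNgt => ? ?;
  apply/andP; split; lra.
Qed.

Definition cst (a : R[i]) : contfun X := a *: (1 : contfun X).

Lemma ev_cst a x : ev (cst a) x = a.
Proof. by rewrite contfunZ contfun1 mulr1. Qed.

Definition sqnorm f : contfun X := cconj f * f.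

Lemma ev_sqnorm f x : ev (sqnorm f) x = (cabs (ev f x) ^+ 2)%:C.
Proof. by rewrite contfunM ev_conj mulrC mul_conjC. Qed.

Definition sqdist y : contfun X := sqnorm (cincl X - cst (pt y)).

Lemma ev_sqdist y x : ev (sqdist y) x = (cabs (pt x - pt y) ^+ 2)%:C.
Proof. by rewrite ev_sqnorm contfunD contfunN ev_cst ev_cincl. Qed.

(** Korovkin's estimate: within distance [d] of [y] continuity gives [e]; farther away the
    oscillation is at most [2 B], which [2 B / d^2] times the squared distance exceeds. *)
Lemma osc_le_sqdist f y (e : R) : compact X -> 0 < e -> exists2 C : R, 0 <= C &
  forall x, cabs (ev f x - ev f y) <= e + C * cabs (pt x - pt y) ^+ 2.
Proof.
move=> cX e0; have [d d0 fd] := contfun_cvg f y e0.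
have [B B0 fB] := contfun_bounded cX f.
have d20 : 0 < d ^+ 2 by rewrite exprn_gt0.
have C0 : 0 <= 2 * B / d ^+ 2 by rewrite divr_ge0 ?mulr_ge0 // ltW.
exists (2 * B / d ^+ 2) => // x.
have [/fd xy|xy] := ltP (cabs (pt x - pt y)) d.
  apply: le_trans (ltW xy) _; rewrite lerDl.
  by rewrite mulr_ge0 ?exprn_ge0 ?cabs_ge0.
apply: (@le_trans _ _ (2 * B)).
  by apply: le_trans (cabsB_le _ _) _; have := fB x; have := fB y; lra.
apply: (@le_trans _ _ (2 * B / d ^+ 2 * cabs (pt x - pt y) ^+ 2)); last first.
  by rewrite lerDr ltW.
rewrite mulrAC -mulrA -[leLHS]mulr1 ler_wpM2l ?mulr_ge0 //.
by rewrite ler_pdivlMr // mul1r ler_pXn2r // nnegrE ?cabs_ge0 // ltW.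
Qed.

End ContinuousConstructions.

Section Means.
Context (R : realType) (X : set R[i]^o).
Hypotheses (cX : compact X) (X0 : X !=set0).
Implicit Types (f g : contfun X) (x y : set_type X) (psi : contfun X -> R).

(* The real part of a state of C(X). *)
Definition mean psi := [/\ forall f g, psi (f + g) = psi f + psi g,
  forall (r : R) f, psi (r%:C *: f) = r * psi f
  & forall f (b : R), (forall x, complex.Re (ev f x) <= b) -> psi f <= b].

Section MeanTheory.
Variable psi : contfun X -> R.
Hypothesis mpsi : mean psi.

Lemma meanN f : psi (- f) = - psi f.
Proof. by have [_ psiZ _] := mpsi; have := psiZ (-1) f;
  rewrite rmorphN scaleN1r mulN1r. Qed.

Lemma mean_le f g : (forall x, complex.Re (ev f x) <= complex.Re (ev g x)) ->
  psi f <= psi g.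
Proof.
move=> fg; have [psiD _ psile] := mpsi.
rewrite -subr_le0 -meanN -psiD; apply: psile => x.
by have := fg x; rewrite contfunD contfunN; case: (ev f x) => ? ?;
  case: (ev g x) => ? ? /=; lra.
Qed.

Lemma mean_cst (r : R) : psi (cst X r%:C) = r.
Proof.
have [_ psiZ psile] := mpsi; apply/eqP; rewrite eq_le psile => [|x]; last first.
  by rewrite ev_cst.
rewrite -lerN2 -meanN; apply: psile => x.
by rewrite contfunN ev_cst.
Qed.

Lemma mean_ge0 f : (forall x, 0 <= complex.Re (ev f x)) -> 0 <= psi f.
Proof. by move=> f0; rewrite -(mean_cst 0); apply: mean_le => x; rewrite ev_cst. Qed.

Lemma mean_sum (I : Type) (s : seq I) (F : I -> contfun X) :
  psi (\sum_(i <- s) F i) = \sum_(i <- s) psi (F i).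
Proof.
have [psiD psiZ _] := mpsi.
elim: s => [|i s ih]; rewrite ?big_nil ?big_cons ?psiD ?ih //.
by have := psiZ 0 0; rewrite scale0r mul0r.
Qed.

(** By [osc_le_sqdist], [f] differs from the constant [f(y)] by at most [e] plus a multiple of
    [sqdist y], and the mean annihilates that multiple. *)
Lemma mean_point y : psi (sqdist y) = 0 -> forall f, psi f = complex.Re (ev f y).
Proof.
move=> h0; have [psiD psiZ _] := mpsi.
have le f : psi f <= complex.Re (ev f y).
  apply/ler_addgt0Pr => e e0; have [C C0 fC] := osc_le_sqdist f y cX e0.
  have : psi f <= psi (cst X (complex.Re (ev f y) + e)%:C + C%:C *: sqdist y).
    apply: mean_le => x;
      rewrite contfunD ev_cst contfunZ ev_sqdist -rmorphM -rmorphD /=.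
    have := fC x; have := Re_le_cabs (ev f x - ev f y).
    by rewrite ler_norml; case: (ev f x) => ? ?; case: (ev f y) => ? ? /= /andP[]; lra.
  by rewrite psiD psiZ h0 mean_cst mulr0 addr0.
move=> f; apply/eqP; rewrite eq_le le -lerN2 -meanN /=.
by apply: le_trans (le _) _; rewrite contfunN; case: (ev f y).
Qed.

End MeanTheory.

Lemma mean_convex psi1 psi2 (t : R) : 0 < t < 1 -> mean psi1 -> mean psi2 ->
  mean (fun f => t * psi1 f + (1 - t) * psi2 f).
Proof.
move=> /andP[t0 t1] [D1 Z1 l1] [D2 Z2 l2]; split=> [f g|r f|f b fb].
- by rewrite D1 D2; ring.
- by rewrite Z1 Z2; ring.
- have := l1 _ _ fb; have := l2 _ _ fb => h2 h1.
  have -> : b = t * b + (1 - t) * b by ring.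
  by apply: lerD; apply: ler_wpM2l => //; lra.
Qed.

Lemma ReC_sum (I : Type) (s : seq I) (F : I -> R[i]) :
  complex.Re (\sum_(i <- s) F i) = \sum_(i <- s) complex.Re (F i).
Proof. by elim: s => [|i s ih]; rewrite ?big_nil ?big_cons ?ReD ?ih. Qed.

(* The functions of a partition of unity subordinate to a net are peaked at the
   points of the net, so a mean is close to the discrete measure whose weights
   are the means of these functions. *)
Lemma mean_net psi (e : R) : mean psi -> 0 < e ->
  exists (m : nat) (p : nat -> set_type X) (w : nat -> R),
  [/\ forall k, 0 <= w k, \sum_(k < m) w k = 1,
      forall x, exists2 k : nat, (k < m)%N & cabs (pt x - pt (p k)) < e
    & forall f (b : R), (forall x y, cabs (pt y - pt x) < e -> cabs (ev f y - ev f x) < b) ->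
      `|\sum_(k < m) w k * complex.Re (ev f (p k)) - psi f| <= b].
Proof.
move=> mpsi e0; have [psiD psiZ _] := mpsi.
have [s sX] := compact_net cX e0.
have [z Xz] := X0; pose p := nth (SigSub (mem_set Xz) : set_type X) s.
pose g k : contfun X := contfun_comp (cincl X) (continuousC_bump (pt (p k)) e).
have evg k x : ev (g k) x = (Num.max 0 (e - cabs (pt x - pt (p k))))%:C by [].
have g0 k x : 0 <= Num.max 0 (e - cabs (pt x - pt (p k))) by rewrite le_max lexx.
pose G := \sum_(k < size s) g k.
have evG x : ev G x = (\sum_(k < size s) Num.max 0 (e - cabs (pt x - pt (p k))))%:C.
  by rewrite contfun_sum rmorph_sum.
have G0 x : 0 < \sum_(k < size s) Num.max 0 (e - cabs (pt x - pt (p k))).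
  have [y ys xy] := sX x; have ks : (index y s < size s)%N by rewrite index_mem.
  rewrite (bigD1 (Ordinal ks)) //= ltr_pwDl ?sumr_ge0 //.
  by rewrite lt_max /p nth_index // subr_gt0 xy orbT.
have Gn0 x : ev G x != 0 by rewrite evG -(rmorph0 (real_complex R)) (inj_eq (@complexI R)) gt_eqF.
pose h k := g k * contfunV Gn0.
pose q k x := Num.max 0 (e - cabs (pt x - pt (p k))) /
   \sum_(j < size s) Num.max 0 (e - cabs (pt x - pt (p j))).
have evh k x : ev (h k) x = (q k x)%:C.
  by rewrite contfunM ev_inv evg evG /q rmorphM /= fmorphV.
have q0 k x : 0 <= q k x by rewrite divr_ge0 // ltW.
have q1 x : \sum_(k < size s) q k x = 1 by rewrite -mulr_suml mulfV // gt_eqF.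
have qe k x : q k x != 0 -> cabs (pt x - pt (p k)) < e.
  rewrite mulf_eq0 negb_or => /andP[+ _].
  by rewrite /Num.max; case: ifPn; rewrite ?eqxx // => h' _; lra.
have sumh : \sum_(k < size s) h k = cst X 1%:C.
  apply: contfunP => x; rewrite contfun_sum ev_cst -(q1 x) rmorph_sum /=.
  by apply: eq_bigr => k _; rewrite evh.
exists (size s), p, (fun k => psi (h k)); split.
- by move=> k; apply: mean_ge0 => // x; rewrite evh; exact: q0.
- by rewrite -(mean_sum mpsi) sumh mean_cst.
- move=> x; have [y ys xy] := sX x.
  by exists (index y s); rewrite ?index_mem // /p nth_index.
- move=> f b fb.
  (* [F] replaces [f(x)] by a convex combination of its values at the net points within [e] of [x],
     so [F] and [f] are uniformly within [b]; applying [psi] to both turns this into the claim. *)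
  pose F := \sum_(k < size s) (complex.Re (ev f (p k)))%:C *: h k.
  have -> : \sum_(k < size s) psi (h k) * complex.Re (ev f (p k)) = psi F.
    by rewrite (mean_sum mpsi); apply: eq_bigr => k _; rewrite psiZ mulrC.
  have evF x : complex.Re (ev F x) = \sum_(k < size s) q k x * complex.Re (ev f (p k)).
    rewrite contfun_sum ReC_sum; apply: eq_bigr => k _.
    by rewrite contfunZ evh -rmorphM /= mulrC.
  have Ff x : `|complex.Re (ev F x) - complex.Re (ev f x)| <= b.
    rewrite evF -[X in _ - X]mul1r -(q1 x) mulr_suml -sumrB.
    apply: le_trans (ler_norm_sum _ _ _) _.
    apply: (@le_trans _ _ (\sum_(k < size s) q k x * b));
      last by rewrite -mulr_suml q1 mul1r.
    apply: ler_sum => k _; rewrite -mulrBr normrM ger0_norm //.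
    have [->|/qe xk] := eqVneq (q k x) 0; first by rewrite !mul0r.
    apply: ler_wpM2l => //; apply/ltW; apply: le_lt_trans (fb _ _ _); last first.
      by rewrite cabs_sym; exact: xk.
    by apply: le_trans (Re_le_cabs _); case: (ev f (p k)) => ? ?; case: (ev f x).
  rewrite ler_norml; apply/andP; split.
    suff : psi f <= psi (F + cst X b%:C) by rewrite psiD mean_cst //; lra.
    apply: mean_le => // x; rewrite contfunD ev_cst ReD /=.
    by have := Ff x; rewrite ler_norml => /andP[]; lra.
  suff : psi F <= psi (f + cst X b%:C) by rewrite psiD mean_cst //; lra.
  apply: mean_le => // x; rewrite contfunD ev_cst ReD /=.
  by have := Ff x; rewrite ler_norml => /andP[]; lra.
Qed.

End Means.

(** * Extension of states of a subspace, and points off the Choquet boundary *)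

Section States.
Context (R : realType) (X : set R[i]^o) (M : set (contfun X)).
Hypotheses (cX : compact X) (X0 : X !=set0) (sM : subspace_of M) (M1 : M 1).
Implicit Types (f g : contfun X) (x y : set_type X) (L : set_type M -> R[i]^o).

Let sub f (Mf : M f) : set_type M := SigSub (mem_set Mf).

Lemma subspaceD f g : M f -> M g -> M (f + g).
Proof. by move=> Mf Mg; have := sM.2 1 f g Mf Mg; rewrite scale1r. Qed.

Lemma subspaceZ (a : R[i]) f : M f -> M (a *: f).
Proof. by move=> Mf; have := sM.2 a f 0 Mf sM.1; rewrite addr0. Qed.

Lemma set_typeM (u : set_type M) : M (val u).
Proof. by have := valP u; rewrite inE. Qed.

Section FunctionalTheory.
Variable L : set_type M -> R[i]^o.
Hypothesis lL : functional_linear L.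
Implicit Types u v w : set_type M.

Lemma functionalD u v w : val w = val u + val v -> L w = L u + L v :> R[i].
Proof. by move=> e; have := lL (a := 1) (f := u) (g := v) (h := w);
  rewrite scale1r mul1r; exact. Qed.

Lemma functional0 u : val u = 0 -> L u = 0 :> R[i].
Proof.
move=> u0; have := @functionalD u u u; rewrite u0 addr0 => /(_ erefl).
by move/(congr1 (fun z : R[i] => z - L u)); rewrite subrr addrK.
Qed.

Lemma functionalZ (a : R[i]) u v : val v = a *: val u -> L v = a * (L u : R[i]) :> R[i].
Proof.
move=> e; have := lL (a := a) (f := u) (g := sub sM.1) (h := v).
by rewrite /= addr0 => /(_ e) ->; rewrite (functional0 (u := sub sM.1)) // addr0.
Qed.

Hypotheses (bL : functional_bounded L) (nL : functional_norm L = 1)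
  (L1 : forall u, val u = 1 -> L u = 1).

Lemma functional_le u (r : R) : 0 < r -> (forall x, cabs (ev (val u) x) <= r) ->
  cabs (L u) <= r.
Proof.
move=> r0 ur; have ri0 : 0 < r^-1 by rewrite invr_gt0.
pose v := sub (subspaceZ (r^-1)%:C (set_typeM u)).
have Lv : L v = (r^-1)%:C * (L u : R[i]) :> R[i] by apply: functionalZ.
have v1 : supnorm (val v) <= 1.
  apply: supnorm_le => // x; rewrite contfunZ cabsM cabsR gtr0_norm //.
  by rewrite ler_pdivrMl // mulr1.
have : cabs (L v) <= 1.
  rewrite -nL; have [k kL] := bL.
  have ub : has_ubound [set rnorm (L f) | f in [set f | supnorm (val f) <= 1]].
    exists `|k| => _ [f /= f1 <-]; apply: le_trans (kL f) _.
    have s0 : 0 <= supnorm (val f).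
      have [z Xz] := X0;
        apply: le_trans (cabs_ge0 _) (cabs_le_supnorm cX (val f) (SigSub (mem_set Xz))).
    apply: (@le_trans _ _ (`|k| * supnorm (val f))).
      by apply: ler_wpM2r => //; exact: ler_norm.
    by rewrite -[leRHS]mulr1 ler_wpM2l.
  by apply: (ub_le_sup ub); exists v.
by rewrite Lv cabsM cabsR gtr0_norm // ler_pdivrMl // mulr1.
Qed.

(* A half plane is exhausted by large discs, and a functional of norm one taking
   the value one at 1 preserves inclusion of the range in a disc. *)
Lemma functional_Re_le u (b : R) : (forall x, complex.Re (ev (val u) x) <= b) ->
  complex.Re (L u) <= b.
Proof.
move=> ub; rewrite leNgt; apply/negP => ba; set a := complex.Re (L u) in ba.
have [K K0 uK] := contfun_bounded cX (val u).
(* The disc of centre [- s] and radius [s + c] contains all points of modulus at most [K] with real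
   part at most [b] as soon as [K^2 <= s (a - b)], because [2 s c = s (a - b) + 2 s b]. It then
   contains [L u], so [a <= c], against [b < a]. The summand [|c| + 1] makes [s] and [s + c]
   positive. *)
pose c := (a + b) / 2; pose s := K ^+ 2 / (a - b) + `|c| + 1.
have ab0 : 0 < a - b by rewrite subr_gt0.
have Ks : K ^+ 2 <= s * (a - b).
  rewrite -ler_pdivrMr // /s -addrA lerDl; apply: addr_ge0 => //.
have s0 : 0 < s.
  by rewrite /s ltr_wpDl // addr_ge0 // divr_ge0 ?exprn_ge0 // ltW.
have sc0 : 0 < s + c.
  have : 0 <= K ^+ 2 / (a - b) by rewrite divr_ge0 ?exprn_ge0 // ltW.
  by rewrite /s; have := ler_norm (- c); rewrite normrN; lra.
have M1s : M (val u + cst X s%:C) by apply: subspaceD (set_typeM u) (subspaceZ _ M1).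
have Lus : L (sub M1s) = (L u : R[i]) + s%:C :> R[i].
  rewrite (functionalD (u := u) (v := sub (subspaceZ s%:C M1))) //; congr (_ + _).
  rewrite (functionalZ (a := s%:C) (u := sub M1)) //.
  by rewrite (L1 (u := sub M1)) //; exact: mulr1.
have : cabs (L (sub M1s)) <= s + c.
  apply: functional_le => // x; rewrite /= contfunD ev_cst.
  rewrite -(@ler_pXn2r _ 2) ?nnegrE ?cabs_ge0 ?(ltW sc0) //.
  have : cabs (ev (val u) x) ^+ 2 <= K ^+ 2 by rewrite ler_pXn2r ?nnegrE ?cabs_ge0.
  rewrite !sqr_cabs; have := ub x; case: (ev _ x) => p q /= pb pq; rewrite addr0.
  have sp : s * p <= s * b by apply: ler_wpM2l => //; exact: ltW.
  have c2 := sqr_ge0 c.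
  have -> : (s + c) ^+ 2 = s ^+ 2 + s * (a - b) + 2 * (s * b) + c ^+ 2.
    by rewrite /c; field.
  have -> : (p + s) ^+ 2 = p ^+ 2 + 2 * (s * p) + s ^+ 2 by ring.
  by lra.
rewrite Lus => h; have := le_trans (Re_le_cabs _) h.
rewrite ReD /= -/a => /ler_normlW; rewrite /c; lra.
Qed.

End FunctionalTheory.

(** The real part of [L] is dominated by the supremum of the real part, which is sublinear on all of
    C(X). Hahn-Banach extends it under the same bound, and that bound is the last clause of
    [mean]. *)
Lemma state_mean L : state_space L -> exists psi, mean psi /\
  forall u : set_type M, psi (val u) = complex.Re (L u).
Proof.
case=> lL bL L1 nL; have [z Xz] := X0.
pose x0 : set_type X := SigSub (mem_set Xz).
pose ub f := has_ubound (range (fun x => complex.Re (ev f x))).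
pose p f := sup (range (fun x => complex.Re (ev f x))).
have pub f x : complex.Re (ev f x) <= p f.
  have [B _ fB] := contfun_bounded cX f.
  have ubf : ub f.
    by exists B => _ [y _ <-]; apply: le_trans (fB y);
      apply: le_trans (ler_norm _) (Re_le_cabs _).
  by apply: (ub_le_sup ubf); exists x.
have ple f b : (forall x, complex.Re (ev f x) <= b) -> p f <= b.
  by move=> fb; apply: ge_sup; [exists (complex.Re (ev f x0)), x0|move=> _ [y _ <-]].
have sp : sublinear p.
  split=> [f g|r f r0].
    by apply: (ple _ _) => x; rewrite contfunD ReD lerD.
  have le s h : 0 < s -> p (s%:C *: h) <= s * p h.
    by move=> s0; apply: (ple _ _) => x; rewrite contfunZ ReRM ler_pM2l.
  apply/eqP; rewrite eq_le le //=; have ri0 : 0 < r^-1 by rewrite invr_gt0.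
  have := le r^-1 (r%:C *: f) ri0.
  by rewrite scalerA -rmorphM mulVf ?gt_eqF // scale1r ler_pdivlMl.
(* [L] lives on the type [set_type M], whereas Hahn-Banach takes a function on the whole space; the
   value 0 off [M] is a placeholder. *)
pose LM f := if pselect (M f) is left Mf then complex.Re (L (sub Mf)) else 0.
have LMu (u : set_type M) : LM (val u) = complex.Re (L u).
  rewrite /LM; case: pselect => [Mu|]; last by move/(_ (set_typeM u)).
  by congr (complex.Re (L _)); apply: val_inj.
have LME f (Mf : M f) : LM f = complex.Re (L (sub Mf)) by rewrite -LMu.
have [||||||psi [psiD psiZ psip psiM]] := @hahn_banach _ _ p M LM sp.
- exact: sM.1.
- exact: subspaceD.
- by move=> r f; apply: subspaceZ.
- move=> f g Mf Mg; rewrite (LME _ Mf) (LME _ Mg) (LME _ (subspaceD Mf Mg)).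
  by rewrite -ReD; congr complex.Re; apply: functionalD.
- move=> r f Mf; rewrite (LME _ Mf) (LME _ (subspaceZ r%:C Mf)) -ReRM.
  by congr complex.Re; apply: functionalZ.
- move=> f Mf; rewrite (LME _ Mf); apply: functional_Re_le => // x; exact: pub.
exists psi; split; last by move=> u; rewrite psiM ?LMu //; exact: set_typeM.
by split=> // f b fb; apply: le_trans (psip f) (ple _ _ fb).
Qed.

Lemma point_state (l : set_type X) : state_space (fun f : set_type M => val (val f) l).
Proof.
have le (f : set_type M) : rnorm (val (val f) l) <= supnorm (val f).
  exact: (cabs_le_supnorm cX (val f) l).
split=> [a f g h ->//||u ->//|]; first by exists 1 => f; rewrite mul1r.
have ub1 : ubound [set rnorm (val (val f) l) | f in [set f : set_type M | supnorm (val f) <= 1]] 1.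
  by move=> _ [f /= f1 <-]; apply: le_trans (le f) f1.
have one : [set rnorm (val (val f) l) | f in [set f : set_type M | supnorm (val f) <= 1]] 1.
  exists (sub M1) => /=; last by rewrite -(cabs1 R).
  by apply: supnorm_le => // x; rewrite contfun1 cabs1.
apply/eqP; rewrite eq_le; apply/andP; split.
  by apply: ge_sup => //; exists 1.
by apply: ub_le_sup => //; exists 1.
Qed.

(** If the mixture of the two extended states vanished at [sqdist l], so would each of them, both
    being nonnegative there. [mean_point] would make both evaluations at [l], and the convex
    decomposition would be trivial. *)
Lemma choquet_mean : choquet_boundary M <> setT ->
  exists (l : set_type X) psi, [/\ mean psi,
    forall f, M f -> psi f = complex.Re (ev f l) & 0 < psi (sqdist l)].
Proof.
move=> nC; have [l nl] : exists l, ~ choquet_boundary M l.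
  by apply: contrapT => /forallNP h; apply: nC; apply/seteqP; split=> // l _;
    exact: contrapT.
have {nl} [L1 [L2 [t [s1 s2 t01 dE nL]]]] : exists (L1 L2 : set_type M -> R[i]^o) (t : R),
  [/\ state_space L1, state_space L2, 0 < t < 1,
  (fun f : set_type M => val (val f) l) = t%:C *: L1 + (1 - t)%:C *: L2
  & ~ (L1 = (fun f : set_type M => val (val f) l) /\ L2 = (fun f : set_type M => val (val f) l))].
  apply: contrapT => h; apply: nl; split; first exact: point_state.
  move=> L1 L2 t s1 s2 t01 dE; apply: contrapT => nL.
  by apply: h; exists L1, L2, t.
have [psi1 [m1 psi1E]] := state_mean s1; have [psi2 [m2 psi2E]] := state_mean s2.
have mpsi := mean_convex t01 m1 m2; have /andP[t0 t1] := t01.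
exists l, (fun f => t * psi1 f + (1 - t) * psi2 f); split=> //.
  move=> f Mf; rewrite -[f]/(val (sub Mf)) psi1E psi2E -!ReRM -ReD.
  by congr complex.Re; have /(congr1 (fun F => F (sub Mf))) := dE.
rewrite lt_def; apply/andP; split; last first.
  by apply: (mean_ge0 mpsi) => x; rewrite ev_sqdist /= exprn_ge0 // cabs_ge0.
apply/eqP => h0; apply: nL.
have p1 : 0 <= psi1 (sqdist l).
  by apply: mean_ge0 => // x; rewrite ev_sqdist /= exprn_ge0 // cabs_ge0.
have p2 : 0 <= psi2 (sqdist l).
  by apply: mean_ge0 => // x; rewrite ev_sqdist /= exprn_ge0 // cabs_ge0.
have tp1 := mulr_ge0 (ltW t0) p1.
have t1' : 0 < 1 - t by rewrite subr_gt0.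
have tp2 := mulr_ge0 (ltW t1') p2.
have z1 : psi1 (sqdist l) = 0.
  have : t * psi1 (sqdist l) = 0 by lra.
  by move/eqP; rewrite mulf_eq0 gt_eqF //= => /eqP.
have z2 : psi2 (sqdist l) = 0.
  have : (1 - t) * psi2 (sqdist l) = 0 by lra.
  by move/eqP; rewrite mulf_eq0 gt_eqF //= => /eqP.
have point L psi : state_space L -> mean psi ->
    (forall u : set_type M, psi (val u) = complex.Re (L u)) -> psi (sqdist l) = 0 ->
    L = (fun f : set_type M => val (val f) l).
  move=> [lL _ _ _] mp pL pz; apply/funext => u.
  have ReL v : complex.Re (L v) = complex.Re (ev (val v) l).
    by rewrite -pL; exact: (mean_point cX mp pz).
  (* Means see only real parts; the imaginary part of [L u] is recovered from the real part at
     ['i *: u]. *)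
  have Mi : M ('i *: val u) := subspaceZ 'i (set_typeM u).
  have := ReL (sub Mi); rewrite (functionalZ lL (a := 'i) (u := u)) // contfunZ !ReMi.
  move/oppr_inj => ImL; have := ReL u; move: ImL.
  by rewrite /ev; case: (L u) => a b; case: (val (val u) l) => c d /= -> ->.
by split; [apply: point s1 m1 psi1E z1|apply: point s2 m2 psi2E z2].
Qed.

End States.

(** * Approximation of means by finitely supported measures *)

Section Approximation.
Context (R : realType) (X : set R[i]^o).
Hypotheses (cX : compact X) (X0 : X !=set0).
Implicit Types (f g : contfun X) (x y : set_type X).

(** The complex-linear functional with real part [psi]: its imaginary part at [f] is minus its real
    part at ['i *: f]. *)
Definition mean_value (psi : contfun X -> R) (f : contfun X) : R[i] :=
  psi f +i* - psi ('i *: f).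

(** Nets of mesh [1 / (n + 1)] suffice by uniform continuity, applied to [f] and to ['i *: f]. The
    density of the support points is recorded because it later makes a diagonal representation
    faithful. *)
Lemma mean_approximation (psi : contfun X -> R) : mean psi ->
  exists (m : nat -> nat) (p : nat -> nat -> set_type X) (w : nat -> nat -> R),
  [/\ forall n k, 0 <= w n k, forall n, \sum_(k < m n) w n k = 1,
      forall x (e : R), 0 < e -> exists n, exists2 k, (k < m n)%N & cabs (pt x - pt (p n k)) < e
    & forall f, cabs (\sum_(k < m n) (w n k)%:C * ev f (p n k) - mean_value psi f)
        @[n --> \oo] --> (0 : R)].
Proof.
move=> mpsi.
have e0 n : 0 < n.+1%:R^-1 :> R by rewrite invr_gt0.
pose P n (d : nat * (nat -> set_type X) * (nat -> R)) :=
  [/\ forall k, 0 <= d.2 k, \sum_(k < d.1.1) d.2 k = 1,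
      forall x, exists2 k : nat, (k < d.1.1)%N & cabs (pt x - pt (d.1.2 k)) < n.+1%:R^-1
    & forall f (b : R), (forall x y, cabs (pt y - pt x) < n.+1%:R^-1 -> cabs (ev f y - ev f x) < b) ->
      `|\sum_(k < d.1.1) d.2 k * complex.Re (ev f (d.1.2 k)) - psi f| <= b].
have /choice[D DP] : forall n, exists d, P n d.
  move=> n; have [m [p [w H]]] := mean_net cX X0 mpsi (e0 n).
  by exists (m, p, w).
exists (fun n => (D n).1.1), (fun n => (D n).1.2), (fun n => (D n).2).
have small (e : R) : 0 < e -> \forall n \near \oo, n.+1%:R^-1 < e.
  move=> e1; have := @near_infty_natSinv_lt R (PosNum e1); apply: filterS => n /=;
    exact.
have conv f : `|\sum_(k < (D n).1.1) (D n).2 k * complex.Re (ev f ((D n).1.2 k)) - psi f|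
    @[n --> \oo] --> (0 : R).
  apply/cvgrPdist_le => e e1; have [d d0 fd] := contfun_unif cX f e1.
  apply: filterS (small _ d0) => n nd; rewrite sub0r normrN normr_id.
  have [_ _ _] := DP n; apply=> x y xy; apply: fd; exact: lt_trans xy nd.
split=> [n k|n|x e e1|f]; try by have [] := DP n.
  have [n _ /(_ n (leqnn n)) ne] := small _ e1.
  have [_ _ /(_ x)[k km xk] _] := DP n.
  by exists n, k => //; apply: lt_trans xk ne.
apply: (@squeeze_cvgr _ _ _ _ (fun=> 0) (fun n =>
  `|\sum_(k < (D n).1.1) (D n).2 k * complex.Re (ev f ((D n).1.2 k)) - psi f| +
  `|\sum_(k < (D n).1.1) (D n).2 k * complex.Re (ev ('i *: f) ((D n).1.2 k)) - psi ('i *: f)|)).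
- apply: nearW => n; rewrite cabs_ge0 /=.
  set S := \sum_(k < _) _%:C * _.
  have -> : \sum_(k < (D n).1.1) (D n).2 k * complex.Re (ev f ((D n).1.2 k)) = complex.Re S.
    by rewrite ReC_sum; apply: eq_bigr => k _; rewrite ReRM.
  have -> : \sum_(k < (D n).1.1) (D n).2 k * complex.Re (ev ('i *: f) ((D n).1.2 k)) = - complex.Im S.
    by rewrite -ReMi mulr_sumr ReC_sum; apply: eq_bigr => k _;
      rewrite contfunZ mulrCA ReRM.
  case: S => a b; rewrite /mean_value /=.
  rewrite -(@ler_pXn2r _ 2) ?nnegrE ?cabs_ge0 ?addr_ge0 // sqr_cabs /= opprK.
  rewrite -[X in _ <= (_ + X) ^+ 2]normrN opprD !opprK.
  set u := a - _; set v := b + _; have -> : u ^+ 2 + v ^+ 2 = `|u| ^+ 2 + `|v| ^+ 2.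
    by rewrite !real_normK ?num_real.
  have := mulr_ge0 (normr_ge0 u) (normr_ge0 v); rewrite sqrrD; lra.
- exact: cvg_cst.
- by have := cvgD (conv f) (conv ('i *: f)); rewrite addr0; exact.
Qed.

End Approximation.

(** * Hilbert spaces and bounded operators *)

Lemma cvg0_le (R : realType) (T : Type) (F : set_system T) (FF : Filter F) (f g : T -> R) :
  (forall x, 0 <= f x <= g x) -> g @ F --> (0 : R) -> f @ F --> (0 : R).
Proof.
move=> fg g0; have c0 := @cvg_cst _ (0 : R) _ F FF.
by apply: (squeeze_cvgr _ c0 g0); apply: nearW.
Qed.

Section InnerProduct.
Context (R : realType) (H : hilbert R).
Implicit Types (x y z : H) (a b : R[i]).

Definition nrm x : R := rnorm x.

Lemma normE_nrm x : `|x| = (nrm x)%:C.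
Proof. by rewrite /nrm /rnorm RRe_real // normr_real. Qed.

Lemma innerC x y : inner y x = Num.conj (inner x y).
Proof. by rewrite (hermitian_subproof (s := inner (h := H)) y x) expr0 mul1r. Qed.

Lemma innerDl x y z : inner (x + y) z = inner x z + inner y z.
Proof. by rewrite linearDl. Qed.

Lemma innerDr x y z : inner x (y + z) = inner x y + inner x z.
Proof. by rewrite linearDr. Qed.

Lemma innerZl a x y : inner (a *: x) y = a * inner x y.
Proof. by rewrite linearZl_LR. Qed.

Lemma innerZr a x y : inner x (a *: y) = Num.conj a * inner x y.
Proof. by rewrite linearZr_LR. Qed.

Lemma innerNl x y : inner (- x) y = - inner x y.
Proof. by rewrite -scaleN1r innerZl mulN1r. Qed.

Lemma innerNr x y : inner x (- y) = - inner x y.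
Proof. by rewrite -scaleN1r innerZr rmorphN rmorph1 mulN1r. Qed.

Lemma innerBl x y z : inner (x - y) z = inner x z - inner y z.
Proof. by rewrite innerDl innerNl. Qed.

Lemma innerBr x y z : inner x (y - z) = inner x y - inner x z.
Proof. by rewrite innerDr innerNr. Qed.

Lemma inner0l y : inner 0 y = 0.
Proof. by rewrite -(scale0r 0) innerZl mul0r. Qed.

Lemma inner0r y : inner y 0 = 0.
Proof. by rewrite innerC inner0l rmorph0. Qed.

Lemma inner_suml (I : Type) (s : seq I) (F : I -> H) y :
  inner (\sum_(i <- s) F i) y = \sum_(i <- s) inner (F i) y.
Proof. by elim: s => [|i s ih]; rewrite ?big_nil ?inner0l // !big_cons innerDl ih. Qed.

Lemma inner_sumr (I : Type) (s : seq I) (F : I -> H) y :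
  inner y (\sum_(i <- s) F i) = \sum_(i <- s) inner y (F i).
Proof. by elim: s => [|i s ih]; rewrite ?big_nil ?inner0r // !big_cons innerDr ih. Qed.

Lemma inner_nrm x : inner x x = (nrm x ^+ 2)%:C.
Proof. by rewrite innerE normE_nrm rmorphXn. Qed.

Lemma nrm_ge0 x : 0 <= nrm x.
Proof. by rewrite -ler0c -normE_nrm. Qed.

Lemma nrm0 : nrm 0 = 0.
Proof. by rewrite /nrm /rnorm normr0. Qed.

Lemma nrmN x : nrm (- x) = nrm x.
Proof. by rewrite /nrm /rnorm normrN. Qed.

Lemma nrm_eq0 x : nrm x = 0 -> x = 0.
Proof. by move=> x0; apply/normr0_eq0; rewrite normE_nrm x0. Qed.

Lemma nrmD x y : nrm (x + y) <= nrm x + nrm y.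
Proof. by rewrite -lecR rmorphD /= -!normE_nrm ler_normD. Qed.

Lemma nrmZ a x : nrm (a *: x) = cabs a * nrm x.
Proof. by apply: complexI;
  rewrite rmorphM /= -normE_nrm normrZ normE_cabs normE_nrm. Qed.

Lemma inner_eq0 x : inner x x = 0 -> x = 0.
Proof.
rewrite inner_nrm => /(@complexI _ _ 0)/eqP; rewrite sqrf_eq0 => /eqP.
exact: nrm_eq0.
Qed.

Lemma sqr_nrm x (r : R) : inner x x = r%:C -> nrm x ^+ 2 = r.
Proof. by rewrite inner_nrm => /complexI. Qed.

Lemma nrm_unit x : inner x x = 1 -> nrm x = 1.
Proof.
move/(@sqr_nrm x 1)/eqP; rewrite sqrf_eq1 => /orP[/eqP//|/eqP h].
by have := nrm_ge0 x; lra.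
Qed.

Lemma inner_cauchy x y : cabs (inner x y) <= nrm x * nrm y.
Proof.
have [->|y0] := eqVneq y 0; first by rewrite inner0r cabs0 nrm0 mulr0.
have ny : 0 < nrm y.
  by rewrite lt_def nrm_ge0 andbT; apply: contra_neq y0; exact: nrm_eq0.
(* The component of [x] orthogonal to [y], scaled by [nrm y ^+ 2] to avoid a division; its squared
   norm is [nrm y ^+ 2] times the desired difference. *)
pose c := inner x y; pose z := (nrm y ^+ 2)%:C *: x - c *: y.
have : inner z z = (nrm y ^+ 2 * (nrm x ^+ 2 * nrm y ^+ 2 - cabs c ^+ 2))%:C.
  rewrite /z innerBl !innerBr !innerZl !innerZr !conjC_real !inner_nrm -/c.
  rewrite (innerC x y) -/c [in RHS]rmorphM [in RHS]rmorphB [in RHS]rmorphM /= -mul_conjC.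
  by ring.
move/sqr_nrm => nz; have : 0 <= nrm x ^+ 2 * nrm y ^+ 2 - cabs c ^+ 2.
  by rewrite -(pmulr_rge0 _ (exprn_gt0 2 ny)) -nz exprn_ge0 // nrm_ge0.
rewrite subr_ge0 -exprMn ler_pXn2r // nnegrE ?cabs_ge0 //.
by rewrite mulr_ge0 ?nrm_ge0.
Qed.

Lemma cvgH_nrm (T : Type) (F : set_system T) (FF : Filter F) (f : T -> H) (l : H) :
  (f @ F --> l) <-> (nrm (f x - l) @[x --> F] --> (0 : R)).
Proof.
split=> [/cvgrPdist_lt fl|/cvgrPdist_lt fl]; apply/cvgrPdist_lt => e e0.
  have /fl : 0 < e%:C by rewrite ltcR.
  apply: filterS => x /=; rewrite distrC normE_nrm ltcR.
  by rewrite sub0r normrN ger0_norm ?nrm_ge0.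
have [r r0 ->] := complex_gt0P e0.
apply: filterS (fl _ r0) => x /=.
by rewrite sub0r normrN ger0_norm ?nrm_ge0 // distrC normE_nrm ltcR.
Qed.

Lemma cvg_inner (T : Type) (F : set_system T) (FF : Filter F) (f : T -> H) (l y : H) :
  (f @ F --> l) -> cabs (inner (f x) y - inner l y) @[x --> F] --> (0 : R).
Proof.
move/cvgH_nrm => fl; apply: (@cvg0_le _ _ _ _ _ (fun t => nrm (f t - l) * nrm y)).
  by move=> x; rewrite cabs_ge0 -innerBl inner_cauchy.
by rewrite -[X in _ --> X](mul0r (nrm y)); apply: cvgMl.
Qed.

Section Orthonormal.
Variables (I : eqType) (e : I -> H).
Definition orthonormal_family := forall i j, inner (e i) (e j) = (i == j)%:R.
Hypothesis eo : orthonormal_family.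

Lemma inner_sum_basis (s : seq I) (a : I -> R[i]) (j : I) : uniq s ->
  inner (\sum_(i <- s) a i *: e i) (e j) = if j \in s then a j else 0.
Proof.
move=> us; rewrite inner_suml; case: ifP => js.
  rewrite (bigD1_seq j) //= innerZl eo eqxx mulr1 big1 ?addr0 // => i ij.
  by rewrite innerZl eo (negbTE ij) mulr0.
rewrite big_seq big1 // => i iS; rewrite innerZl eo.
by have [ij|] := eqVneq i j; [rewrite ij js in iS|rewrite mulr0].
Qed.

Lemma sqr_nrm_sum (s : seq I) (a : I -> R[i]) : uniq s ->
  nrm (\sum_(i <- s) a i *: e i) ^+ 2 = \sum_(i <- s) cabs (a i) ^+ 2.
Proof.
move=> us; apply: sqr_nrm; rewrite inner_sumr rmorph_sum /= big_seq [RHS]big_seq.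
apply: eq_bigr => i iS; rewrite innerZr inner_sum_basis // iS mulrC.
exact: mul_conjC.
Qed.

Lemma bessel (s : seq I) x : uniq s ->
  \sum_(i <- s) cabs (inner x (e i)) ^+ 2 <= nrm x ^+ 2.
Proof.
move=> us; pose v := \sum_(i <- s) inner x (e i) *: e i.
have nv := sqr_nrm_sum (fun i => inner x (e i)) us; rewrite -/v in nv.
have xv : inner x v = (nrm v ^+ 2)%:C.
  rewrite nv inner_sumr rmorph_sum; apply: eq_bigr => i _.
  by rewrite innerZr mulrC; exact: mul_conjC.
have : inner (x - v) (x - v) = (nrm x ^+ 2 - nrm v ^+ 2)%:C.
  rewrite innerBl !innerBr (innerC x v) xv conjC_real !inner_nrm subrr subr0.
  by rewrite rmorphB.
by move/sqr_nrm; rewrite -nv => h; rewrite -subr_ge0 -h exprn_ge0 // nrm_ge0.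
Qed.

End Orthonormal.

End InnerProduct.

Section OrthonormalSequence.
Context (R : realType) (H : hilbert R).

(** A finite orthonormal list does not span, so some vector has a nonzero residual after projection,
    and normalizing it extends the list. The sequence is read off from nested lists, each prolonging
    the previous one. *)
Lemma orthonormal_sequence : infinite_dimensional H ->
  exists e : nat -> H, orthonormal_family e.
Proof.
move=> infH.
pose ortho (s : seq H) := forall i j, (i < size s)%N -> (j < size s)%N ->
  inner s`_i s`_j = (i == j)%:R :> R[i].
have ext s : ortho s -> exists x, inner x x = 1 /\ forall y, y \in s -> inner x y = 0.
  move=> os; apply: contrapT => nx; apply: infH.
  exists (size s), (fun i => s`_i) => x.
  pose c (i : 'I_(size s)) := inner x s`_i; exists c.
  pose v := x - \sum_i c i *: s`_i.
  have vs y : y \in s -> inner v y = 0.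
    move=> /(nthP 0)[j js <-]; rewrite innerBl inner_suml (bigD1 (Ordinal js)) //=.
    rewrite innerZl os // eqxx mulr1 big1 ?addr0 ?subrr // => i ij; rewrite innerZl.
    have -> : inner s`_i s`_j = 0 :> R[i].
      rewrite os //; have [eij|//] := eqVneq (i : nat) j.
      by case/eqP: ij; exact: val_inj.
    by rewrite mulr0.
  apply/eqP; rewrite -subr_eq0 -/v; apply/eqP; apply: contrapT => /eqP v0; apply: nx.
  have nv : nrm v != 0 by apply: contra_neq v0; exact: nrm_eq0.
  exists ((nrm v)^-1%:C *: v); split=> [|y /vs vy]; last by rewrite innerZl vy mulr0.
  rewrite innerZl innerZr conjC_real inner_nrm -!rmorphM /=.
  by rewrite expr2 mulKf // mulVf.
have /choice[F FP] : forall s, exists x, ortho s -> inner x x = 1 /\ forall y, y \in s -> inner x y = 0.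
  move=> s; have [/ext[x xP]|ns] := pselect (ortho s); first by exists x.
  by exists 0 => /ns.
pose l := fix l n := if n is k.+1 then rcons (l k) (F (l k)) else [::].
have sl n : size (l n) = n by elim: n => //= n ih; rewrite size_rcons ih.
have lo n : ortho (l n).
  elim: n => //= n ih i j; rewrite size_rcons sl => im jm.
  have [F1 F0] := FP _ ih; have mem k : (k < n)%N -> (l n)`_k \in l n.
    by move=> kn; rewrite mem_nth // sl.
  have top k : (k < n.+1)%N -> (n <= k)%N -> k = n.
    by rewrite ltnS => kn nk; apply/eqP; rewrite eqn_leq kn nk.
  rewrite !nth_rcons sl.
  case: (ltnP i n) => [ltin|/(top _ im) ->]; case: (ltnP j n) => [ltjn|/(top _ jm) ->].
  - by rewrite ih ?sl.
  - by rewrite eqxx innerC F0 ?mem // rmorph0 ltn_eqF.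
  - by rewrite eqxx F0 ?mem // gtn_eqF.
  - by rewrite !eqxx F1.
have lnth n k : (k < n)%N -> (l n)`_k = F (l k).
  elim: n => // n ih; rewrite ltnS leq_eqVlt => /predU1P[->|kn] /=.
    by rewrite nth_rcons sl ltnn eqxx.
  by rewrite nth_rcons sl kn ih.
exists (fun n => F (l n)) => i j; pose n := (maxn i j).+1.
have im : (i < n)%N by rewrite ltnS leq_maxl.
have jm : (j < n)%N by rewrite ltnS leq_maxr.
by rewrite -(lnth n i) // -(lnth n j) // lo ?sl.
Qed.

End OrthonormalSequence.

Section Operators.
Context (R : realType) (H : hilbert R).
Implicit Types (A B : bop H) (x y z : H).

Lemma bop_linear A (a : R[i]) x y : val A (a *: x + y) = a *: val A x + val A y.
Proof. by have /asboolP[lA _] := valP A; exact: lA. Qed.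

Lemma bopD A x y : val A (x + y) = val A x + val A y.
Proof. by have := bop_linear A 1 x y; rewrite !scale1r. Qed.

Lemma bop0 A : val A 0 = 0.
Proof. by have /(congr1 (fun z => z - val A 0)) := bopD A 0 0;
  rewrite addr0 addrK subrr. Qed.

Lemma bopZ A (a : R[i]) x : val A (a *: x) = a *: val A x.
Proof. by have := bop_linear A a x 0; rewrite bop0 !addr0. Qed.

Lemma bopB A x y : val A (x - y) = val A x - val A y.
Proof. by rewrite bopD -scaleN1r bopZ scaleN1r. Qed.

Lemma bopE A B : (forall x, val A x = val B x) -> A = B.
Proof. by move=> AB; apply/val_inj/funext. Qed.

Lemma bop_bounded A : exists2 k : R, 0 <= k & forall x, nrm (val A x) <= k * nrm x.
Proof.
have /asboolP[_ [k kA]] := valP A; exists `|k| => // x.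
have := kA x; rewrite !normE_nrm -rmorphM lecR => h; apply: le_trans h _.
by apply: ler_wpM2r (ler_norm _); exact: nrm_ge0.
Qed.

Lemma bop_exists (f : H -> H) (k : R) :
  (forall (a : R[i]) x y, f (a *: x + y) = a *: f x + f y) ->
  (forall x, nrm (f x) <= k * nrm x) -> exists A : bop H, forall x, val A x = f x.
Proof.
move=> lf kf; have fP : f \in bop_pred H.
  by apply/asboolP; split=> //; exists k => x; rewrite !normE_nrm -rmorphM lecR.
by exists (exist _ f fP).
Qed.

Lemma nrm_le_opnorm A x : nrm x <= 1 -> nrm (val A x) <= opnorm A.
Proof.
move=> x1; have [k k0 kA] := bop_bounded A.
have ub : has_ubound [set rnorm (val A x) | x in [set x : H | `|x| <= 1]].
  exists k => _ [y /= y1 <-]; apply: le_trans (kA y) _.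
  rewrite -[leRHS]mulr1 ler_wpM2l //.
  by move: y1; rewrite normE_nrm -(rmorph1 (real_complex R)) lecR.
apply: (ub_le_sup ub); exists x => //=.
by rewrite normE_nrm -(rmorph1 (real_complex R)) lecR.
Qed.

Lemma opnorm_le A (k : R) : 0 <= k -> (forall x, nrm (val A x) <= k * nrm x) -> opnorm A <= k.
Proof.
move=> k0 kA; apply: ge_sup; first by exists (rnorm (val A 0)), 0;
  rewrite //= normr0 ler01.
move=> _ [y /= y1 <-]; apply: le_trans (kA y) _.
rewrite -[leRHS]mulr1 ler_wpM2l //.
by move: y1; rewrite normE_nrm -(rmorph1 (real_complex R)) lecR.
Qed.

End Operators.

(** * Diagonal operators and representations *)

Section DiagonalOperators.
Context (R : realType) (H : hilbert R) (e : nat -> H).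
Hypothesis eo : orthonormal_family e.
Implicit Types (x y z u v : H) (c : nat -> R[i]).

Definition perp y := forall i, inner y (e i) = 0.

(** The family [e] need not be complete, as [H] may be non-separable; equality is therefore tested
    on the family and on its orthogonal complement. *)
Lemma basis_ext u v : (forall i, inner u (e i) = inner v (e i)) ->
  (forall y, perp y -> inner u y = inner v y) -> u = v.
Proof.
move=> uvi uvp; apply/eqP; rewrite -subr_eq0; apply/eqP/inner_eq0.
have p : perp (u - v) by move=> i; rewrite innerBl uvi subrr.
by rewrite innerBl uvp // subrr.
Qed.

Lemma cvgC_unique (f : nat -> R[i]) (a b : R[i]) :
  cabs (f n - a) @[n --> \oo] --> (0 : R) -> cabs (f n - b) @[n --> \oo] --> (0 : R) -> a = b.
Proof.
move=> fa fb; apply/eqP; rewrite -subr_eq0; apply/eqP/cabs_eq0.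
have : cabs (a - b) @[n --> \oo] --> (0 : R).
  apply: (@cvg0_le _ _ _ _ _ (fun n => cabs (f n - a) + cabs (f n - b))).
    move=> n; rewrite cabs_ge0 /= -(subrKA (f n)) (cabs_sym (f n) a).
    exact: cabsD.
  by have := cvgD fa fb; rewrite addr0; exact.
by move/cvg_lim => <- //; rewrite lim_cst.
Qed.

(** Riesz-Fischer: by Pythagoras the series is Cauchy when the squares are summable, completeness of
    [H] gives the sum, and the properties of the partial sums pass to the limit. *)
Lemma basis_sum (a : nat -> R[i]) (K : R) : 0 <= K ->
  (forall n, \sum_(0 <= k < n) cabs (a k) ^+ 2 <= K ^+ 2) ->
  exists v, [/\ forall i, inner v (e i) = a i, forall y, perp y -> inner v y = 0,
    nrm v <= K & nrm (\sum_(0 <= k < n) a k *: e k - v) @[n --> \oo] --> (0 : R)].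
Proof.
move=> K0 aK; pose S n := \sum_(0 <= k < n) a k *: e k.
have cvgS : cvgn (series (fun k => a k *: e k)).
  apply/cauchy_cvgP/cauchy_seriesP => d /complex_gt0P[r r0 ->].
  have : cvgn (series (fun k => cabs (a k) ^+ 2)).
    apply: nondecreasing_is_cvgn.
      by apply: nondecreasing_series => k _; rewrite exprn_ge0 // cabs_ge0.
    by exists (K ^+ 2) => _ [n _ <-]; exact: aK.
  move=> /cauchy_cvgP/cauchy_seriesP/(_ (r ^+ 2)); rewrite exprn_gt0 // => /(_ isT).
  apply: filterS => -[m n] /=; rewrite ger0_norm ?sumr_ge0 //; last first.
    by move=> k _; rewrite exprn_ge0 // cabs_ge0.
  rewrite -(sqr_nrm_sum eo) ?iota_uniq // ltr_pXn2r ?nnegrE ?nrm_ge0 ?ltW //.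
  by rewrite normE_nrm ltcR.
pose v := limn (series (fun k => a k *: e k)).
have Sv : nrm (S n - v) @[n --> \oo] --> (0 : R) by apply/cvgH_nrm; exact: cvgS.
have Sn n : nrm (S n) <= K.
  rewrite -(@ler_pXn2r _ 2) ?nnegrE ?nrm_ge0 //.
  by rewrite (sqr_nrm_sum eo) ?iota_uniq.
have Si y : cabs (inner (S n) y - inner v y) @[n --> \oo] --> (0 : R).
  by apply: cvg_inner; apply/cvgH_nrm.
exists v; split=> //.
- move=> i; apply: (cvgC_unique (Si (e i))).
  apply/cvgrPdist_lt => d d0; exists i.+1 => // n /= ni.
  rewrite (inner_sum_basis eo) ?iota_uniq // mem_index_iota /= ni.
  by rewrite subrr cabs0 subr0 normr0.
- move=> y py; apply: (cvgC_unique (Si y)).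
  have S0 n : inner (S n) y = 0.
    rewrite inner_suml big1 // => k _.
    by rewrite innerZl (innerC y) py rmorph0 mulr0.
  by under eq_fun do rewrite S0 subr0 cabs0; exact: cvg_cst.
- apply/ler_addgt0Pr => d d0;
  move/cvgrPdist_lt: Sv => /(_ _ d0)[n _ /(_ n (leqnn n))] /=.
  rewrite sub0r normrN ger0_norm ?nrm_ge0 // => nd.
  rewrite -(subrK (S n) v); apply: le_trans (nrmD _ _) _.
  by have := Sn n; rewrite -(nrmN (v - S n)) opprB; lra.
Qed.

Lemma basis_expansion x : exists r, perp r /\
  nrm (\sum_(0 <= k < n) inner x (e k) *: e k - (x - r)) @[n --> \oo] --> (0 : R).
Proof.
have [n|v [vi _ _ vl]] := @basis_sum (fun k => inner x (e k)) (nrm x) (nrm_ge0 x).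
  by rewrite (bessel eo) // iota_uniq.
exists (x - v); split=> [i|]; first by rewrite innerBl vi subrr.
by have -> : x - (x - v) = v by rewrite opprB addrC subrK.
Qed.

Lemma functional_ext (phi : H -> R[i]) (K : R) :
  (forall (a : R[i]) x y, phi (a *: x + y) = a * phi x + phi y) ->
  (forall x, cabs (phi x) <= K * nrm x) ->
  (forall i, phi (e i) = 0) -> (forall y, perp y -> phi y = 0) ->
  forall x, phi x = 0.
Proof.
move=> lphi Kphi phie phip x; have [r [pr rl]] := basis_expansion x.
have phi0 : phi 0 = 0.
  by have := lphi (-1) 0 0; rewrite scaler0 addr0 mulN1r addNr.
have phiD y z : phi (y + z) = phi y + phi z by rewrite -{1}(scale1r y) lphi mul1r.
have phiS n : phi (\sum_(0 <= k < n) inner x (e k) *: e k) = 0.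
  by elim/big_rec: _ => // k z _ pz; rewrite lphi phie mulr0 add0r.
have phixr : phi (x - r) = 0.
  apply: cabs_eq0; apply/eqP; rewrite eq_le cabs_ge0 andbT.
  apply/ler_addgt0Pr => d d0; rewrite add0r.
  have rl' : K * nrm (\sum_(0 <= k < n) inner x (e k) *: e k - (x - r)) @[n --> \oo] --> (0 : R).
    by rewrite -[X in _ --> X](mulr0 K); apply: cvgMr.
  move/cvgrPdist_lt: rl' => /(_ _ d0)[n _ /(_ n (leqnn n))] /=.
  rewrite sub0r normrN => /(le_lt_trans (ler_norm _)) nd; apply: le_trans (ltW nd).
  apply: le_trans (Kphi _); rewrite (phiD _ (- (x - r))) phiS add0r.
  by rewrite -(scaleN1r (x - r)) -[X in _ <= cabs (phi X)]addr0 lphi phi0 addr0 mulN1r cabsN.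
by rewrite -(subrK r x) phiD phixr (phip _ pr) addr0.
Qed.

(** Eigenvalue [c i] at [e i] and [c0] on the complement, phrased through inner products of values:
    by [basis_ext] these determine [D], so that algebraic identities between diagonal operators
    become identities between eigenvalues, without infinite sums. *)
Definition is_diagonal (D : bop H) (c0 : R[i]) c :=
  (forall x i, inner (val D x) (e i) = c i * inner x (e i)) /\
  forall x y, perp y -> inner (val D x) y = c0 * inner x y.

Lemma diagonal_exists (c0 : R[i]) c (B : R) : (forall i, cabs (c i) <= B) ->
  exists D, is_diagonal D c0 c.
Proof.
move=> cB; have B0 : 0 <= B := le_trans (cabs_ge0 _) (cB 0).
pose C := B + cabs c0; have C0 : 0 <= C by rewrite addr_ge0 // cabs_ge0.
(* [S] is the operator minus [c0]. Its coefficients are square-summable by Bessel's inequality, with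
   factor [C] bounding all [c i - c0]. *)
have /choice[S SP] : forall x, exists v, [/\ forall i, inner v (e i) = (c i - c0) * inner x (e i),
    forall y, perp y -> inner v y = 0 & nrm v <= C * nrm x].
  move=> x; have [||v [vi vp vn _]] := @basis_sum (fun i => (c i - c0) * inner x (e i)) (C * nrm x).
  - by rewrite mulr_ge0 // nrm_ge0.
  - move=> n; rewrite exprMn.
    apply: le_trans (ler_wpM2l (exprn_ge0 2 C0) (bessel eo x (iota_uniq 0 (n - 0)))).
    rewrite mulr_sumr; apply: ler_sum => i _.
    rewrite cabsM exprMn ler_wpM2r ?exprn_ge0 ?cabs_ge0 // ler_pXn2r ?nnegrE ?cabs_ge0 //.
    by apply: le_trans (cabsB_le _ _) _; rewrite lerD2r.
  by exists v.
have [||D DE] := @bop_exists _ H (fun x => c0 *: x + S x) (cabs c0 + C).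
- move=> a x y; apply: basis_ext => [i|z pz].
    have [Sxy _ _] := SP (a *: x + y); have [Sx _ _] := SP x; have [Sy _ _] := SP y.
    by rewrite !(innerDl, innerZl) Sxy Sx Sy ?(innerDl, innerZl); ring.
  have [_ Sxy _] := SP (a *: x + y); have [_ Sx _] := SP x; have [_ Sy _] := SP y.
  by rewrite !(innerDl, innerZl) Sxy // Sx // Sy // ?(innerDl, innerZl); ring.
- move=> x; apply: le_trans (nrmD _ _) _; rewrite nrmZ mulrDl lerD2l.
  by have [] := SP x.
exists D; split=> [x i|x y py]; rewrite DE innerDl innerZl.
  by have [-> _ _] := SP x; ring.
by have [_ -> // _] := SP x; rewrite addr0.
Qed.

Section DiagonalTheory.
Variables (D : bop H) (c0 : R[i]) (c : nat -> R[i]).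
Hypothesis dD : is_diagonal D c0 c.

Lemma diagonal_basis i : val D (e i) = c i *: e i.
Proof.
apply: basis_ext => [j|y py].
  rewrite dD.1 innerZl eo; have [->//|_] := eqVneq i j.
  by rewrite !mulr0.
by rewrite dD.2 // innerZl (innerC y) py rmorph0 !mulr0.
Qed.

Lemma diagonal_perp y : perp y -> val D y = c0 *: y.
Proof.
move=> py; apply: basis_ext => [j|z pz]; last by rewrite dD.2 // innerZl.
by rewrite dD.1 innerZl py !mulr0.
Qed.

Lemma diagonal_unique D' : is_diagonal D' c0 c -> D = D'.
Proof.
move=> dD'; apply: bopE => x; apply: basis_ext => [i|y py].
  by rewrite dD.1 dD'.1.
by rewrite dD.2 // dD'.2.
Qed.

(** The difference of the two sides is a bounded linear functional of [x] that vanishes on every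
    [e i] and on the complement, hence everywhere by [functional_ext]. *)
Lemma diagonal_adjoint D' : is_diagonal D' (Num.conj c0) (fun i => Num.conj (c i)) ->
  is_adjoint D D'.
Proof.
move=> dD' x y; have [k k0 kD] := bop_bounded D; have [k' k'0 kD'] := bop_bounded D'.
apply/eqP; rewrite -subr_eq0; apply/eqP; move: x.
apply: (@functional_ext (fun x => inner (val D x) y - inner x (val D' y)) (k * nrm y + k' * nrm y)).
- by move=> a x z; rewrite bop_linear !(innerDl, innerZl); ring.
- move=> x; apply: le_trans (cabsB_le _ _) _; rewrite mulrDl; apply: lerD.
    apply: le_trans (inner_cauchy _ _) _; rewrite mulrAC.
    by apply: ler_wpM2r (kD x); exact: nrm_ge0.
  apply: le_trans (inner_cauchy _ _) _; rewrite mulrC.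
  by apply: ler_wpM2r (kD' y); exact: nrm_ge0.
- move=> i; rewrite diagonal_basis innerZl (innerC (val D' y)) dD'.1 rmorphM /= conjCK.
  by rewrite -innerC subrr.
- move=> z pz; rewrite diagonal_perp // innerZl (innerC (val D' y)) dD'.2 // rmorphM /= conjCK.
  by rewrite -innerC subrr.
Qed.

End DiagonalTheory.

Lemma diagonal_finite D (c0 : R[i]) c (m : nat) x : is_diagonal D c0 c ->
  (forall k, (m <= k)%N -> c k = c0) ->
  val D x = c0 *: x + \sum_(0 <= k < m) ((c k - c0) * inner x (e k)) *: e k.
Proof.
move=> dD cm; apply: basis_ext => [i|y py].
  rewrite dD.1 innerDl innerZl (inner_sum_basis eo) ?iota_uniq // mem_index_iota /=.
  by case: ltnP => im; [|rewrite cm //]; ring.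
rewrite dD.2 // innerDl innerZl inner_suml big1 ?addr0 // => k _.
by rewrite innerZl (innerC y) py rmorph0 mulr0.
Qed.

End DiagonalOperators.

Section Representations.
Context (R : realType) (X : set R[i]^o) (H : hilbert R).
Hypothesis cX : compact X.
Implicit Types (f g : contfun X) (v x y : H) (p : set_type X).

Section RepresentationTheory.
Variable pi : contfun X -> bop H.
Hypothesis rpi : representation pi.

Lemma repD f g : pi (f + g) = pi f + pi g.
Proof. by have [lpi _ _ _] := rpi; have := lpi 1 f g; rewrite !scale1r. Qed.

Lemma rep0 : pi 0 = 0.
Proof. by have /(congr1 (fun A => A - pi 0)) := repD 0 0;
  rewrite addr0 addrK subrr. Qed.

Lemma repZ (a : R[i]) f : pi (a *: f) = a *: pi f.
Proof. by have [lpi _ _ _] := rpi; have := lpi a f 0; rewrite rep0 !addr0. Qed.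

Lemma repB f g : pi (f - g) = pi f - pi g.
Proof. by rewrite repD -scaleN1r repZ scaleN1r. Qed.

Lemma rep_cst (a : R[i]) v : val (pi (cst X a)) v = a *: v.
Proof. by have [_ pi1 _ _] := rpi; rewrite repZ pi1. Qed.

Lemma rep_sqnorm f v : inner (val (pi (sqnorm f)) v) v = (nrm (val (pi f) v) ^+ 2)%:C.
Proof.
have [_ _ piM pia] := rpi; rewrite piM /= innerC -(pia f v (val (pi f) v)).
by rewrite inner_nrm conjC_real.
Qed.

Lemma rep_ge0 f v : (forall p, 0 <= ev f p) -> 0 <= complex.Re (inner (val (pi f) v) v).
Proof.
move=> f0; have <- : sqnorm (csqrt f) = f by rewrite /sqnorm cconj_csqrt csqrtK.
by rewrite rep_sqnorm exprn_ge0 // nrm_ge0.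
Qed.

(* [|f - f(p)|^2 <= d + C |z - p|^2] on X, and the right-hand side acts on an
   eigenvector for the eigenvalue p as the constant d. *)
Lemma rep_eigenvector f p v : val (pi (cincl X)) v = pt p *: v ->
  val (pi f) v = ev f p *: v.
Proof.
move=> vp; pose g := f - cst X (ev f p).
have piz : val (pi (cincl X - cst X (pt p))) v = 0.
  by rewrite repB /= fctE -[X in X = _]/(val (pi (cincl X)) v - val (pi (cst X (pt p))) v) rep_cst vp subrr.
suff : val (pi g) v = 0.
  rewrite repB -[X in X = _]/(val (pi f) v - val (pi (cst X (ev f p))) v) rep_cst.
  by move/eqP; rewrite subr_eq0 => /eqP.
apply: nrm_eq0; apply/eqP; rewrite -sqrf_eq0 eq_le exprn_ge0 ?nrm_ge0 // andbT.
have le d : 0 < d -> nrm (val (pi g) v) ^+ 2 <= d * nrm v ^+ 2.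
  move=> d0; have [C C0 gC] := osc_le_sqdist (sqnorm g) p cX d0.
  have gp : ev g p = 0 by rewrite contfunD contfunN ev_cst subrr.
  have := @rep_ge0 (cst X d%:C + C%:C *: sqdist p - sqnorm g) v _.
  rewrite repB repD repZ.
  rewrite -[X in inner X _]/((val (pi (cst X d%:C)) v + C%:C *: val (pi (sqdist p)) v) - val (pi (sqnorm g)) v).
  rewrite innerBl innerDl innerZl !rep_sqnorm piz nrm0 expr0n /= mulr0 addr0 rep_cst innerZl.
  rewrite inner_nrm -rmorphM -rmorphB /= subr_ge0; apply=> q.
  rewrite contfunD contfunN contfunD ev_cst contfunZ ev_sqdist ev_sqnorm.
  rewrite -rmorphM -rmorphD -rmorphB ler0c /= subr_ge0; apply: le_trans (gC q).
  rewrite !ev_sqnorm gp cabs0 expr0n /= subr0 cabsR ger0_norm //.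
  by rewrite exprn_ge0 // cabs_ge0.
apply/ler_addgt0Pr => d d0; rewrite add0r.
have n0 : 0 < nrm v ^+ 2 + 1 by rewrite ltr_wpDl // exprn_ge0 // nrm_ge0.
apply: le_trans (le _ (divr_gt0 d0 n0)) _.
rewrite mulrAC ler_pdivrMr // ler_wpM2l ?ltW //; lra.
Qed.

Lemma rep_normal f : normal_op (pi f).
Proof.
have [_ _ piM pia] := rpi; exists (pi (cconj f)); split; first exact: pia.
by rewrite -!piM mulrC.
Qed.

(** For [l] outside [X] the function [z - l] has no zero on [X], and the representation carries its
    inverse in C(X) to an inverse operator. *)
Lemma rep_spectrum : spectrum (pi (cincl X)) `<=` X.
Proof.
move=> l /= nl; apply: contrapT => nX; apply: nl.
pose f : contfun X := cincl X - cst X l.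
have f0 q : ev f q != 0.
  rewrite contfunD contfunN ev_cst ev_cincl subr_eq0; apply/eqP => ql; apply: nX.
  by rewrite -ql; have := valP q; rewrite inE.
have [_ pi1 piM _] := rpi.
have -> : pi (cincl X) - (l : R[i]) *: (1 : bop H) = pi f by rewrite repB repZ pi1.
have fV : f * contfunV f0 = 1.
  by apply: contfunP => q; rewrite contfunM ev_inv mulfV.
by exists (pi (contfunV f0)); rewrite -!piM [in X in _ /\ X]mulrC fV.
Qed.

End RepresentationTheory.

Section DiagonalRepresentation.
Variables (e : nat -> H) (l : set_type X) (p : nat -> set_type X).
Hypothesis eo : orthonormal_family e.

Definition diagonal_rep (pi : contfun X -> bop H) :=
  forall f, is_diagonal e (pi f) (ev f l) (fun i => ev f (p i)).

Lemma diagonal_rep_exists : exists pi, diagonal_rep pi.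
Proof.
have /choice[pi piP] : forall f, exists D, is_diagonal e D (ev f l) (fun i => ev f (p i)).
  move=> f; have [B _ fB] := contfun_bounded cX f.
  by apply: (diagonal_exists eo) => i; exact: fB.
by exists pi.
Qed.

Variable pi : contfun X -> bop H.
Hypothesis dpi : diagonal_rep pi.

Lemma diagonal_representation : representation pi.
Proof.
split=> [a f g||f g|f].
- apply: (diagonal_unique (c0 := ev (a *: f + g) l) (dpi _)); split=> [x i|x y py].
    rewrite -[X in inner X _]/(a *: val (pi f) x + val (pi g) x) innerDl innerZl.
    by rewrite !(dpi _).1 contfunD contfunZ; ring.
  rewrite -[X in inner X _]/(a *: val (pi f) x + val (pi g) x) innerDl innerZl.
  by rewrite !(dpi _).2 // contfunD contfunZ; ring.
- apply: (diagonal_unique (dpi _)); split=> [x i|x y py];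
    by rewrite contfun1 mul1r.
- apply: (diagonal_unique (dpi _)); split=> [x i|x y py].
    by rewrite /= !(dpi _).1 contfunM mulrA.
  by rewrite /= !(dpi _).2 // contfunM mulrA.
- by apply: (diagonal_adjoint eo (dpi f)); exact: (dpi (cconj f)).
Qed.

(** The representation selected by [fcalc] agrees with [pi] at [z], hence has the same eigenvectors
    there. By [rep_eigenvector] they are eigenvectors for every function, and passing to the adjoint
    shows its value at [f] to be diagonal with the eigenvalues of [pi f]. *)
Lemma fcalc_diagonal f : fcalc (pi (cincl X)) f = pi f.
Proof.
have rpi := diagonal_representation.
rewrite /fcalc; case: xgetP => [pi' _ [rpi' pi'z]|/(_ pi)];
  last by move/(_ (conj rpi erefl)).
have [_ _ _ pia'] := rpi'.
have eb g i : val (pi' g) (e i) = ev g (p i) *: e i.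
  apply: (rep_eigenvector rpi'); rewrite pi'z; exact: (diagonal_basis eo (dpi _)).
have ep g y : perp e y -> val (pi' g) y = ev g l *: y.
  move=> py; apply: (rep_eigenvector rpi'); rewrite pi'z;
    exact: (diagonal_perp (dpi (cincl X)) py).
apply: (diagonal_unique (c0 := ev f l) (c := fun i => ev f (p i)) _ (dpi _)).
split=> [x i|x y py].
  by rewrite pia' eb innerZr ev_conj conjCK.
by rewrite pia' ep // innerZr ev_conj conjCK.
Qed.

Lemma diagonal_rep_inj :
  (forall (x : set_type X) (d : R), 0 < d -> exists i, cabs (pt x - pt (p i)) < d) -> injective pi.
Proof.
move=> dense f g fg; have fgi i : ev f (p i) = ev g (p i).
  have := diagonal_basis eo (dpi f) i; rewrite fg (diagonal_basis eo (dpi g)).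
  move/(congr1 (fun x => inner x (e i))); rewrite !innerZl eo eqxx !mulr1.
  by [].
apply: contfunP => q; apply/eqP; rewrite -subr_eq0; apply/eqP/cabs_eq0.
apply/eqP; rewrite eq_le cabs_ge0 andbT; apply/ler_addgt0Pr => d d0; rewrite add0r.
have [r r0 fr] := contfun_cvg (f - g) q d0; have [i qi] := dense q r r0.
have := fr (p i); rewrite cabs_sym => /(_ qi).
rewrite (contfunD f (- g) (p i)) contfunN fgi subrr sub0r cabsN => h.
exact: ltW.
Qed.

End DiagonalRepresentation.
End Representations.

(** * Weak limits *)

Section Reflection.
Context (R : realType) (H : hilbert R) (e0 : H) (g : nat -> H) (m : nat) (t : nat -> R).
Hypotheses (go : orthonormal_family g) (e01 : inner e0 e0 = 1)
  (ge0 : forall k, inner (g k) e0 = 0) (t1 : \sum_(0 <= k < m) t k ^+ 2 = 1)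
  (tm : forall k, (m <= k)%N -> t k = 0).

Let s := \sum_(0 <= k < m) (t k)%:C *: g k.

(** Since [e0 - s] has squared norm 2, the reflection exchanging [e0] and [s] is
    [x - <x, e0 - s> (e0 - s)], and [<g k, e0 - s> = - t k]. For [k >= m] it fixes [g k]. *)
Definition reflected k : H := g k + (t k)%:C *: (e0 - s).

Let e0g k : inner e0 (g k) = 0.
Proof. by rewrite innerC ge0 rmorph0. Qed.

Let sg k : inner s (g k) = (t k)%:C.
Proof.
rewrite (inner_sum_basis go (fun k => (t k)%:C)) ?iota_uniq // mem_index_iota /=.
by case: ltnP => // km; rewrite tm.
Qed.

Let gs k : inner (g k) s = (t k)%:C.
Proof. by rewrite innerC sg conjC_real. Qed.

Let se0 : inner s e0 = 0.
Proof. by rewrite inner_suml big1 // => k _; rewrite innerZl ge0 mulr0. Qed.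

Let e0s : inner e0 s = 0.
Proof. by rewrite innerC se0 rmorph0. Qed.

Let ss : inner s s = 1.
Proof.
rewrite inner_nrm (sqr_nrm_sum go) ?iota_uniq // -(rmorph1 (real_complex R)) -t1.
by congr (_%:C); apply: eq_bigr => k _; rewrite cabsR real_normK ?num_real.
Qed.

Lemma reflected_orthonormal : orthonormal_family reflected.
Proof.
move=> i j; rewrite /reflected !(innerDl, innerDr, innerZl, innerZr, innerNl, innerNr).
by rewrite !conjC_real go ge0 e0g gs sg ss se0 e0s e01; ring.
Qed.

Lemma inner_e0_reflected k : inner e0 (reflected k) = (t k)%:C.
Proof. by rewrite /reflected innerDr innerZr innerBr e0g e01 e0s conjC_real; ring. Qed.

(** The left sum is the right one minus [|<y, s>|^2], because the squares of the [t k] add up to 1.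
    Off [e0], estimates may thus use the vectors [g k], to which Bessel's inequality applies
    simultaneously for all stages. *)
Lemma sum_reflected_le y : inner y e0 = 0 ->
  \sum_(0 <= k < m) cabs (inner y (reflected k)) ^+ 2 <= \sum_(0 <= k < m) cabs (inner y (g k)) ^+ 2.
Proof.
move=> ye0; pose a k := inner y (g k); pose z := inner y s.
have zE : z = \sum_(0 <= k < m) (t k)%:C * a k.
  by rewrite /z inner_sumr; apply: eq_bigr => k _; rewrite innerZr conjC_real.
have yr k : inner y (reflected k) = a k - (t k)%:C * z.
  by rewrite /reflected innerDr innerZr innerBr ye0 conjC_real sub0r mulrN.
suff : \sum_(0 <= k < m) cabs (inner y (reflected k)) ^+ 2 =
    \sum_(0 <= k < m) cabs (a k) ^+ 2 - cabs z ^+ 2.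
  by move=> ->; rewrite lerBlDr lerDl exprn_ge0 // cabs_ge0.
apply: (@complexI R); rewrite rmorphB !rmorph_sum /= -mul_conjC.
have -> : \sum_(0 <= k < m) (cabs (inner y (reflected k)) ^+ 2)%:C =
   \sum_(0 <= k < m) ((cabs (a k) ^+ 2)%:C - Num.conj z * ((t k)%:C * a k)
     - z * Num.conj ((t k)%:C * a k) + z * Num.conj z * (t k ^+ 2)%:C).
  apply: eq_bigr => k _; rewrite yr -!mul_conjC rmorphB !rmorphM /= conjC_real.
  by ring.
have zCE : \sum_(0 <= k < m) Num.conj ((t k)%:C * a k) = Num.conj z.
  by rewrite zE rmorph_sum.
have t1C : \sum_(0 <= k < m) (t k ^+ 2)%:C = 1 :> R[i].
  by rewrite -(rmorph1 (real_complex R)) -t1 rmorph_sum.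
by rewrite big_split /= !sumrB -!mulr_sumr zCE t1C; rewrite zE; ring.
Qed.

Section Diagonal.
Variables (D : bop H) (c0 : R[i]) (c : nat -> R[i]).
Hypotheses (dD : is_diagonal reflected D c0 c) (cm : forall k, (m <= k)%N -> c k = c0).

Lemma reflected_diagonal_e0 : inner (val D e0) e0 = \sum_(0 <= k < m) (t k ^+ 2)%:C * c k.
Proof.
rewrite (diagonal_finite reflected_orthonormal _ dD cm) innerDl innerZl e01 inner_suml.
have -> : c0 * 1 = \sum_(0 <= k < m) (t k ^+ 2)%:C * c0.
  by rewrite -mulr_suml -(rmorph_sum (real_complex R)) t1 /= rmorph1 mulrC.
rewrite -big_split /=; apply: eq_bigr => k _.
rewrite innerZl inner_e0_reflected (innerC e0) inner_e0_reflected conjC_real rmorphXn /=.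
ring.
Qed.

Lemma reflected_diagonal_perp (C : R) y : (forall k, cabs (c k - c0) <= C) -> inner y e0 = 0 ->
  nrm (val D y - c0 *: y) ^+ 2 <= C ^+ 2 * \sum_(0 <= k < m) cabs (inner y (g k)) ^+ 2.
Proof.
move=> cC ye0; have C0 : 0 <= C := le_trans (cabs_ge0 _) (cC 0).
rewrite (diagonal_finite reflected_orthonormal _ dD cm) addrAC subrr add0r.
rewrite (sqr_nrm_sum reflected_orthonormal) ?iota_uniq //.
apply: le_trans (ler_wpM2l (exprn_ge0 2 C0) (sum_reflected_le ye0)).
rewrite mulr_sumr; apply: ler_sum => k _.
rewrite cabsM exprMn ler_wpM2r ?exprn_ge0 ?cabs_ge0 //.
by rewrite ler_pXn2r ?nnegrE ?cabs_ge0.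
Qed.

End Diagonal.
End Reflection.

Section WeakConvergence.
Context (R : realType) (H : hilbert R) (e0 : H).
Hypothesis e01 : inner e0 e0 = 1.

Lemma rank_one_exists (a b : R[i]) : exists S : bop H,
  forall x, val S x = a *: x + (b * inner x e0) *: e0.
Proof.
have ne0 := nrm_unit e01.
apply: (bop_exists (k := cabs a + cabs b)) => [c x y|x].
  rewrite innerDl innerZl !scalerDr mulrDr scalerDl !scalerA addrACA.
  by congr (_ + _ + (_ *: _ + _)); rewrite ?(mulrC a) // mulrCA.
apply: le_trans (nrmD _ _) _; rewrite !nrmZ ne0 mulr1 cabsM mulrDl lerD2l.
apply: ler_wpM2l; first exact: cabs_ge0.
by apply: le_trans (inner_cauchy _ _) _; rewrite ne0 mulr1.
Qed.

(** Both arguments are split along [e0]. The hypothesis on [D] controls what is orthogonal to [e0]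
    on the left; the mixed term with [e0] on the left is moved to the right by the adjoint, which is
    why [D'] occurs. *)
Lemma wot_cvg_rank_one (D D' : nat -> bop H) (S : bop H) (c0 phi : R[i]) :
  (forall n, is_adjoint (D n) (D' n)) ->
  (forall y, inner y e0 = 0 -> nrm (val (D n) y - c0 *: y) @[n --> \oo] --> (0 : R)) ->
  (forall y, inner y e0 = 0 ->
    nrm (val (D' n) y - Num.conj c0 *: y) @[n --> \oo] --> (0 : R)) ->
  cabs (inner (val (D n) e0) e0 - phi) @[n --> \oo] --> (0 : R) ->
  (forall x, val S x = c0 *: x + ((phi - c0) * inner x e0) *: e0) ->
  wot_cvg D S.
Proof.
move=> DD' Dc D'c De0 SE x z; apply/(cvgC_cabs _).
have split y : exists2 y', y = inner y e0 *: e0 + y' & inner y' e0 = 0.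
  exists (y - inner y e0 *: e0); first by rewrite addrC subrK.
  by rewrite innerBl innerZl e01 mulr1 subrr.
have [x' xE x'0] := split x; have [z' zE z'0] := split z.
set a := inner x e0 in xE; set b := inner z e0 in zE.
have e0z' : inner e0 z' = 0 by rewrite innerC z'0 rmorph0.
have key n : inner (val (D n) x) z - inner (val S x) z =
   a * Num.conj b * (inner (val (D n) e0) e0 - phi)
   + a * inner e0 (val (D' n) z' - Num.conj c0 *: z')
   + inner (val (D n) x' - c0 *: x') z.
  have Sxz : inner (val S x) z = c0 * inner x z + (phi - c0) * a * Num.conj b.
    by rewrite SE innerDl !innerZl -/a (innerC z e0).
  have Dxz : inner (val (D n) x) z = a * inner (val (D n) e0) z + inner (val (D n) x') z.
    by rewrite [in LHS]xE bop_linear innerDl innerZl.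
  have De0z : inner (val (D n) e0) z =
      Num.conj b * inner (val (D n) e0) e0 + inner (val (D n) e0) z'.
    by rewrite [in LHS]zE innerDr innerZr.
  have xz : inner x z = a * Num.conj b + inner x' z.
    by rewrite [in LHS]xE innerDl innerZl (innerC z e0).
  rewrite Sxz Dxz De0z xz innerBr innerZr e0z' -DD' innerBl innerZl.
  by ring.
have ne0 := nrm_unit e01.
apply: (@cvg0_le _ _ _ _ _ (fun n => cabs (a * Num.conj b) * cabs (inner (val (D n) e0) e0 - phi)
  + cabs a * nrm (val (D' n) z' - Num.conj c0 *: z')
  + nrm (val (D n) x' - c0 *: x') * nrm z)).
  move=> n; rewrite cabs_ge0 key /=.
  apply: le_trans (cabsD _ _) _; apply: lerD; last exact: inner_cauchy.
  apply: le_trans (cabsD _ _) _; rewrite !(cabsM _ (inner _ _ - _)) lerD2l (cabsM a).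
  apply: ler_wpM2l (cabs_ge0 _) _ _ _.
  by have := inner_cauchy e0 (val (D' n) z' - Num.conj c0 *: z'); rewrite ne0 mul1r.
have l1 : cabs (a * Num.conj b) * cabs (inner (val (D n) e0) e0 - phi) @[n --> \oo] --> (0 : R).
  by rewrite -[X in _ --> X](mulr0 (cabs (a * Num.conj b))); apply: cvgMr.
have l2 : cabs a * nrm (val (D' n) z' - Num.conj c0 *: z') @[n --> \oo] --> (0 : R).
  by rewrite -[X in _ --> X](mulr0 (cabs a)); apply: cvgMr; exact: D'c.
have l3 : nrm (val (D n) x' - c0 *: x') * nrm z @[n --> \oo] --> (0 : R).
  by rewrite -[X in _ --> X](mul0r (nrm z)); apply: cvgMl; exact: Dc.
by have := cvgD (cvgD l1 l2) l3; rewrite !addr0; exact.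
Qed.

End WeakConvergence.

Section Concentration.
Context (R : realType) (X : set R[i]^o) (H : hilbert R).
Hypothesis cX : compact X.
Variables (E : nat -> H) (l : set_type X) (m : nat -> nat)
  (p : nat -> nat -> set_type X) (w : nat -> nat -> R) (phi : contfun X -> R[i]).
Hypotheses (Eo : orthonormal_family E) (w0 : forall n k, 0 <= w n k)
  (w1 : forall n, \sum_(k < m n) w n k = 1)
  (wphi : forall f, cabs (\sum_(k < m n) (w n k)%:C * ev f (p n k) - phi f)
        @[n --> \oo] --> (0 : R)).
Implicit Types (f : contfun X) (y : H).

(** Coding pairs gives every stage [n] its own vectors, and the successor reserves [E 0] for the
    distinguished unit vector. *)
Definition block (n k : nat) : H := E (pickle (n, k)).+1.

Lemma block_orthonormal n k n' k' :
  inner (block n k) (block n' k') = ((n, k) == (n', k'))%:R.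
Proof. by rewrite Eo eqSS (inj_eq (pcan_inj (@pickleK (nat * nat)%type))). Qed.

Lemma block_perp n k : inner (block n k) (E 0) = 0.
Proof. by rewrite Eo. Qed.

(** All blocks together form one orthonormal family, so Bessel's inequality bounds the series of
    block sums by [nrm y ^+ 2], and its terms tend to 0. *)
Lemma block_sum_cvg y :
  \sum_(0 <= k < m n) cabs (inner y (block n k)) ^+ 2 @[n --> \oo] --> (0 : R).
Proof.
pose e' (nk : nat * nat) := block nk.1 nk.2.
have e'o : orthonormal_family e' by move=> [n k] [n' k']; exact: block_orthonormal.
apply: cvg_series_cvg_0; apply: nondecreasing_is_cvgn.
  by apply: nondecreasing_series => n _; rewrite sumr_ge0 // => k _;
    rewrite exprn_ge0 // cabs_ge0.
exists (nrm y ^+ 2) => _ [N _ <-]; rewrite /series /=.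
have us : uniq [seq (n, k) | n <- index_iota 0 N, k <- index_iota 0 (m n)].
  apply: allpairs_uniq_dep; [exact: iota_uniq|by move=> n _; exact: iota_uniq|].
  by move=> [n k] [n' k'] _ _ /= [-> ->].
have := bessel e'o y us; rewrite big_allpairs_dep; exact.
Qed.

Lemma concentrating_reps : exists Pi : nat -> contfun X -> bop H,
  [/\ forall n, exists (u : nat -> H) (q : nat -> set_type X),
        orthonormal_family u /\ diagonal_rep u l q (Pi n),
      forall n f, inner (val (Pi n f) (E 0)) (E 0) = \sum_(k < m n) (w n k)%:C * ev f (p n k)
    & forall f (S : bop H),
      (forall x, val S x = ev f l *: x + ((phi f - ev f l) * inner x (E 0)) *: E 0) ->
      wot_cvg (fun n => Pi n f) S].
Proof.
(* Square roots, so that [E 0] has weight [w n k] on the reflected vector [k]; zero beyond [m n], so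
   that the remaining vectors stay fixed. *)
pose t n k := if (k < m n)%N then Num.sqrt (w n k) else 0.
have e01 : inner (E 0) (E 0) = 1 by rewrite Eo.
have go n : orthonormal_family (block n).
  by move=> i j; rewrite block_orthonormal xpair_eqE eqxx.
have t2 n : \sum_(0 <= k < m n) t n k ^+ 2 = 1.
  rewrite -(w1 n) big_mkord; apply: eq_bigr => k _.
  by rewrite /t ltn_ord sqr_sqrtr.
have tm n k : (m n <= k)%N -> t n k = 0 by rewrite /t ltnNge => ->.
pose u n := reflected (E 0) (block n) (m n) (t n).
have uo n : orthonormal_family (u n) := reflected_orthonormal (go n) e01 (block_perp n) (t2 n) (tm n).
pose q n k := if (k < m n)%N then p n k else l.
have qm n k f : (m n <= k)%N -> ev f (q n k) = ev f l by rewrite /q ltnNge => ->.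
have /choice[Pi PiP] : forall n, exists pi, diagonal_rep (u n) l (q n) pi.
  by move=> n; exact: diagonal_rep_exists.
have Pie0 n f : inner (val (Pi n f) (E 0)) (E 0) = \sum_(k < m n) (w n k)%:C * ev f (p n k).
  rewrite (reflected_diagonal_e0 (go n) e01 (block_perp n) (t2 n) (tm n) (PiP n f)).
    rewrite big_mkord; apply: eq_bigr => k _.
    by rewrite /t /q ltn_ord sqr_sqrtr.
  by move=> k; exact: qm.
have perp f y : inner y (E 0) = 0 ->
    nrm (val (Pi n f) y - ev f l *: y) @[n --> \oo] --> (0 : R).
  move=> ye0; have [B B0 fB] := contfun_bounded cX f.
  have cB n k : cabs (ev f (q n k) - ev f l) <= B + B.
    by apply: le_trans (cabsB_le _ _) _; apply: lerD; exact: fB.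
  have Bn n := reflected_diagonal_perp (go n) e01 (block_perp n) (t2 n) (tm n) (PiP n f)
     (fun k => @qm n k f) (cB n) ye0.
  apply: (@cvg0_le _ _ _ _ _ (fun n => (B + B) * Num.sqrt (\sum_(0 <= k < m n) cabs (inner y (block n k)) ^+ 2))).
    move=> n; rewrite nrm_ge0 -(@ler_pXn2r _ 2) ?nnegrE ?nrm_ge0 //; last first.
      by rewrite mulr_ge0 ?addr_ge0 // sqrtr_ge0.
    rewrite exprMn sqr_sqrtr ?Bn //.
    by rewrite sumr_ge0 // => k _; rewrite exprn_ge0 // cabs_ge0.
  rewrite -[X in _ --> X](mulr0 (B + B)) -[in X in _ --> X](@sqrtr0 R); apply: cvgMr.
  exact: (continuous_cvg _ (@sqrt_continuous R 0) (block_sum_cvg y)).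
exists Pi; split=> //; first by move=> n; exists (u n), (q n).
move=> f S SE; apply: (wot_cvg_rank_one e01 (D' := fun n => Pi n (cconj f)) _ _ _ _ SE).
- by move=> n; have [_ _ _] := diagonal_representation (uo n) (PiP n); exact.
- exact: perp.
- by move=> y /(perp (cconj f)); rewrite ev_conj; exact.
- by under eq_fun do rewrite Pie0; exact: wphi.
Qed.

End Concentration.

(** * Hyperrigidity *)

Section Compression.
Context (R : realType) (H : hilbert R).
Variables (Q : bop H) (m : nat) (w : nat -> R) (g : nat -> H).
Implicit Types (A B : bop H) (x y : H).

Lemma bop_addE A B x : val (A + B) x = val A x + val B x.
Proof. by []. Qed.

Lemma bop_oppE A x : val (- A) x = - val A x.
Proof. by []. Qed.

Lemma bop_scaleE (a : R[i]) A x : val (a *: A) x = a *: val A x.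
Proof. by []. Qed.

Lemma bop_mulE A B x : val (A * B) x = val A (val B x).
Proof. by []. Qed.

Definition compression A : bop H := (1 - Q) * A * (1 - Q) +
  (\sum_(k < m) (w k)%:C * inner (val A (g k)) (g k)) *: Q.

Fact compression_linear : linear compression.
Proof.
move=> a A B; apply: bopE => x; rewrite /compression.
have -> : \sum_(k < m) (w k)%:C * inner (val (a *: A + B) (g k)) (g k) =
   a * (\sum_(k < m) (w k)%:C * inner (val A (g k)) (g k)) +
   \sum_(k < m) (w k)%:C * inner (val B (g k)) (g k).
  rewrite mulr_sumr -big_split; apply: eq_bigr => k _.
  rewrite (bop_addE (a *: A) B) bop_scaleE innerDl innerZl mulrDr; congr (_ + _).
  by rewrite mulrCA.
move: (\sum_(k < m) _) (\sum_(k < m) _) (1 - Q) => s s' P.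
rewrite !(bop_addE, bop_scaleE, bop_mulE) bop_linear.
by rewrite scalerDl scalerDr scalerA addrACA.
Qed.

HB.instance Definition _ := GRing.isLinear.Build R[i] (bop H) (bop H) _ compression compression_linear.

Definition compressionL : {linear bop H -> bop H} := compression.

Lemma compressionLE A : compressionL A = compression A.
Proof. by []. Qed.

Variable e0 : H.
Hypotheses (e01 : inner e0 e0 = 1) (QE : forall x, val Q x = inner x e0 *: e0)
  (w0 : forall k, 0 <= w k) (w1 : \sum_(k < m) w k = 1) (g1 : forall k, inner (g k) (g k) = 1).

Let P x := x - inner x e0 *: e0.

Let PE x : val (1 - Q) x = P x.
Proof. by rewrite bop_addE bop_oppE QE. Qed.

Let inner_P x y : inner (P x) y = inner x (P y).
Proof.
by rewrite /P innerBl innerBr innerZl innerZr (innerC y e0) mulrC.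
Qed.

Lemma compressionE A x : val (compression A) x =
  P (val A (P x)) + ((\sum_(k < m) (w k)%:C * inner (val A (g k)) (g k)) * inner x e0) *: e0.
Proof. by rewrite bop_addE !bop_mulE !PE bop_scaleE QE scalerA. Qed.

Lemma inner_compression A x y : inner (val (compression A) x) y =
  inner (val A (P x)) (P y) +
  \sum_(k < m) (w k)%:C * inner (val A (inner x e0 *: g k)) (inner y e0 *: g k).
Proof.
rewrite compressionE innerDl inner_P innerZl -mulrA mulr_suml; congr (_ + _).
by apply: eq_bigr => k _; rewrite bopZ innerZl innerZr (innerC y e0); ring.
Qed.

(** By [inner_compression], the form of the image matrix at [x] is the form of [A] at the vectors
    [P (x j)], plus [w k] times its form at the vectors [<x j, e0> g k], summed over [k]. Each of
    these is nonnegative. *)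
Lemma compression_ucp : ucp compressionL.
Proof.
split=> [|n A pA x].
  apply: bopE => x; rewrite compressionLE compressionE.
  have -> : \sum_(k < m) (w k)%:C * inner (val (1 : bop H) (g k)) (g k) = 1.
    rewrite -(rmorph1 (real_complex R)) -w1 rmorph_sum.
    by apply: eq_bigr => k _; rewrite [inner _ _]g1 mulr1.
  rewrite mul1r {1}/P -[X in _ = X]addr0 /P innerBl innerZl e01 mulr1 subrr scale0r.
  by rewrite subr0 subrK addr0.
have -> : \sum_i \sum_j inner (val (map_mx compressionL A i j) (x j)) (x i) =
   \sum_i \sum_j inner (val (A i j) (P (x j))) (P (x i)) +
   \sum_(k < m) (w k)%:C * \sum_i \sum_j
     inner (val (A i j) (inner (x j) e0 *: g k)) (inner (x i) e0 *: g k).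
  under [X in _ = _ + X]eq_bigr => k _ do rewrite mulr_sumr.
  rewrite [X in _ = _ + X]exchange_big -big_split /=; apply: eq_bigr => i _.
  under [X in _ = _ + X]eq_bigr => k _ do rewrite mulr_sumr.
  rewrite [X in _ = _ + X]exchange_big -big_split /=; apply: eq_bigr => j _.
  by rewrite mxE inner_compression.
apply: addr_ge0; first exact: pA.
apply: sumr_ge0 => k _; apply: mulr_ge0; first by rewrite ler0c.
exact: pA.
Qed.

End Compression.

Section Hyperrigidity.
Context (R : realType) (X : set R[i]^o) (H : hilbert R).
Hypothesis cX : compact X.
Variables (E : nat -> H) (l : set_type X) (m : nat -> nat)
  (p : nat -> nat -> set_type X) (w : nat -> nat -> R) (phi : contfun X -> R[i]).
Hypotheses (Eo : orthonormal_family E) (w0 : forall n k, 0 <= w n k)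
  (w1 : forall n, \sum_(k < m n) w n k = 1)
  (wphi : forall f, cabs (\sum_(k < m n) (w n k)%:C * ev f (p n k) - phi f)
        @[n --> \oo] --> (0 : R))
  (dense : forall (x : set_type X) (d : R), 0 < d ->
     exists n, exists2 k, (k < m n)%N & cabs (pt x - pt (p n k)) < d).
Implicit Types (f : contfun X) (x y : H).

(** The vector states at the blocks of stage [n] average to the [n]-th approximating measure, so one
    representation tests all stages. On it the defect of the [n]-th map at [f] is a multiple of the
    projection [Q], with factor the measure of [f] minus [f(l)]; its norm limit therefore compares
    [phi f] with [f(l)]. *)
Lemma hyperrigid_unique_extension (G : set (contfun X)) : hyperrigid G ->
  (forall g, G g -> phi g = ev g l) -> forall f, phi f = ev f l.
Proof.
case=> _ hG phiG f.
(* The eigenvalue is [l] at [E 0] and [p n k] at the block vector coded by [(n, k)]; a number coding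
   no pair receives [l] as default. *)
pose q i := if i is j.+1 then
  if unpickle j is Some nk then p (nk : nat * nat).1 nk.2 else l else l.
have qblock n k : q (pickle (n, k)).+1 = p n k by rewrite /q pickleK.
have [pi dpi] := diagonal_rep_exists cX l q Eo.
have rpi := diagonal_representation Eo dpi.
have ipi : injective pi.
  apply: (diagonal_rep_inj Eo dpi) => x d d0; have [n [k _ xk]] := dense x d0.
  by exists (pickle (n, k)).+1; rewrite qblock.
have e01 : inner (E 0) (E 0) = 1 by rewrite Eo.
have [Q QE0] := rank_one_exists e01 0 1.
have QE x : val Q x = inner x (E 0) *: E 0 by rewrite QE0 scale0r add0r mul1r.
have b1 n k : inner (block E n k) (block E n k) = 1 by rewrite (block_orthonormal Eo) eqxx.
pose Phi n := compressionL Q (m n) (w n) (block E n).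
pose mu n g := \sum_(k < m n) (w n k)%:C * ev g (p n k).
(* [E 0] is an eigenvector of [pi g], so [pi g] commutes with [Q], and compressing by [1 - Q] loses
   only the part [g(l) Q]. *)
have diff n g x : val (Phi n (pi g) - pi g) x = ((mu n g - ev g l) * inner x (E 0)) *: E 0.
  rewrite bop_addE bop_oppE compressionLE (compressionE (m n) (w n) (block E n) QE).
  have -> : \sum_(k < m n) (w n k)%:C * inner (val (pi g) (block E n k)) (block E n k) = mu n g.
    apply: eq_bigr => k _.
    by rewrite /block (diagonal_basis Eo (dpi g)) innerZl b1 qblock mulr1.
  rewrite bopB bopZ (diagonal_basis Eo (dpi g)) /= innerBl !innerZl e01 (dpi g).1 /=.
  rewrite !mulr1 (mulrC (inner x _)) subrr scale0r subr0 scalerA.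
  rewrite mulrBl scalerBl (mulrC (inner x _)) addrAC [X in X + _ = _]addrAC.
  by rewrite subrr add0r addrC.
have ne0 := nrm_unit e01.
have Phi_G g : G g -> opnorm (Phi k (pi g) - pi g) @[k --> \oo] --> (0 : R).
  move=> Gg; apply: (@cvg0_le _ _ _ _ _ _ _ (wphi g)) => n.
  rewrite (phiG _ Gg); apply/andP; split.
    by apply: le_trans (nrm_ge0 _) (nrm_le_opnorm _ (_ : nrm 0 <= 1)); rewrite nrm0.
  apply: opnorm_le => [|x]; first exact: cabs_ge0.
  rewrite diff nrmZ ne0 mulr1 cabsM; apply: ler_wpM2l; first exact: cabs_ge0.
  by apply: le_trans (inner_cauchy _ _) _; rewrite ne0 mulr1.
have cPhi n : ucp (Phi n) := compression_ucp e01 QE (w0 n) (w1 n) (b1 n).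
have := hG H pi rpi ipi Phi cPhi Phi_G f => opf.
apply: (cvgC_unique (wphi f)).
apply: (@cvg0_le _ _ _ _ _ _ _ opf) => n; rewrite cabs_ge0 /=.
have := nrm_le_opnorm (Phi n (pi f) - pi f) (x := E 0).
by rewrite ne0 lexx diff nrmZ ne0 e01 !mulr1; exact.
Qed.

End Hyperrigidity.

(** * The weakly convergent sequence and its scalar companion *)

Theorem theorem10p3 (R : realType) (X : set R[i]^o) (M : set (contfun X)) :
  X !=set0 -> compact X ->
  subspace_of M -> M 1 -> cstar_generated M = setT ->
  choquet_boundary M <> setT ->
  forall H : hilbert R, infinite_dimensional H ->
  exists (T : bop H) (Tn : nat -> bop H),
    [/\ normal_op T, spectrum T `<=` X
      & forall n, normal_op (Tn n) /\ spectrum (Tn n) `<=` X] /\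
    [/\ ~ sot_cvg Tn T,
        forall f : contfun X, exists S, wot_cvg (fun n => fcalc (Tn n) f) S,
        forall f : contfun X, M f ->
          wot_cvg (fun n => fcalc (Tn n) f) (fcalc T f)
      & forall G : set (contfun X),
          countable G -> generators G -> hyperrigid G ->
          exists f0, [/\ G f0, ~ M f0
            & exists S, wot_cvg (fun n => fcalc (Tn n) f0) S /\
                        S <> fcalc T f0]].
Proof.
move=> X0 cX sM M1 _ nC H infH.
have [l [psi [mpsi psiM psil]]] := choquet_mean cX X0 sM M1 nC.
have [m [p [w [w0 w1 dense wphi]]]] := mean_approximation cX X0 mpsi.
have [E Eo] := orthonormal_sequence infH.
have e01 : inner (E 0) (E 0) = 1 by rewrite Eo.
have phiM f : M f -> mean_value psi f = ev f l.
  move=> Mf; rewrite /mean_value (psiM _ Mf) (psiM _ (subspaceZ sM 'i Mf)).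
  by rewrite contfunZ ReMi opprK; case: (ev f l).
have [Pi [PiP Pie0 PiS]] := concentrating_reps cX l Eo w0 w1 wphi.
(* The scalar [l] is presented as a diagonal operator with all eigenvalues [l], so that its
   functional calculus is given by [fcalc_diagonal] too. *)
have [pi0 dpi0] := diagonal_rep_exists cX l (fun=> l) Eo.
have rpi0 := diagonal_representation Eo dpi0.
have fT f : fcalc (pi0 (cincl X)) f = pi0 f := fcalc_diagonal cX Eo dpi0 f.
have pi0E f x : val (pi0 f) x = ev f l *: x.
  by rewrite (diagonal_finite Eo (m := 0) x (dpi0 f)) // big_geq // addr0.
have rPi n : representation (Pi n).
  by have [u [q [uo dn]]] := PiP n; exact: (diagonal_representation uo dn).
have fTn n f : fcalc (Pi n (cincl X)) f = Pi n f.
  by have [u [q [uo dn]]] := PiP n; exact: (fcalc_diagonal cX uo dn f).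
(* The entry of the weak limit at [E 0] is recorded because it recovers [mean_value psi f], to be
   compared with [f(l)]. *)
have limit f : exists S, wot_cvg (fun n => fcalc (Pi n (cincl X)) f) S /\
    inner (val S (E 0)) (E 0) = mean_value psi f.
  have [S SE] := rank_one_exists e01 (ev f l) (mean_value psi f - ev f l).
  exists S; split; first by under eq_fun do rewrite fTn; exact: PiS SE.
  by rewrite SE e01 mulr1 -scalerDl addrC subrK innerZl e01 mulr1.
exists (pi0 (cincl X)), (fun n => Pi n (cincl X)); split.
  split; [exact: rep_normal|exact: rep_spectrum|move=> n].
  by split; [exact: rep_normal|exact: rep_spectrum].
split.
(* The squared norm of [(T_n - l) (E 0)] is the entry of [sqdist l] at [E 0]. Strong convergence
   would send it to 0, whereas it tends to the value of [mean_value psi] there, whose real part is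
   positive. *)
- move=> /(_ (E 0))/cvgH_nrm sot.
  have dist n : val (Pi n (cincl X - cst X (pt l))) (E 0) =
      val (Pi n (cincl X)) (E 0) - val (pi0 (cincl X)) (E 0).
    by rewrite repB // bop_addE bop_oppE rep_cst // pi0E.
  have : cabs (inner (val (Pi n (sqdist l)) (E 0)) (E 0) - 0) @[n --> \oo] --> (0 : R).
    apply: (@cvg0_le _ _ _ _ _ (fun n => nrm (val (Pi n (cincl X)) (E 0) - val (pi0 (cincl X)) (E 0)) *
       nrm (val (Pi n (cincl X)) (E 0) - val (pi0 (cincl X)) (E 0)))).
      move=> n; rewrite subr0 cabs_ge0 rep_sqnorm // dist cabsR expr2.
      by rewrite ger0_norm ?lexx // mulr_ge0 ?nrm_ge0.
    by have := cvgM sot sot; rewrite mulr0; exact.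
  under eq_fun do rewrite Pie0.
  move=> z0; have /(congr1 (@complex.Re R))/= h := cvgC_unique (wphi (sqdist l)) z0.
  by rewrite h ltxx in psil.
- by move=> f; have [S [SE _]] := limit f; exists S.
- move=> f Mf; under eq_fun do rewrite fTn.
  apply: PiS => x; rewrite fT pi0E (phiM _ Mf) subrr mul0r scale0r addr0.
  by [].
(* If no such [f0] exists, then [mean_value psi] agrees with the evaluation at [l] on all of [G]:
   inside [M] by construction, outside by comparing entries at [E 0]. Hyperrigidity extends this to
   [sqdist l], where the evaluation is 0. *)
- move=> G _ _ hG; apply: contrapT => nG.
  have phiG g : G g -> mean_value psi g = ev g l.
    move=> Gg; apply: contrapT => ng; apply: nG; exists g; split=> //.
      by move=> Mg; apply: ng; exact: phiM.
    have [S [SE Se0]] := limit g; exists S; split=> // Sg; apply: ng.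
    by rewrite -Se0 Sg fT pi0E innerZl e01 mulr1.
  have := hyperrigid_unique_extension cX Eo w0 w1 wphi dense hG phiG (sqdist l).
  move/(congr1 (@complex.Re R)); rewrite ev_sqdist subrr cabs0 expr0n /= => h.
  by rewrite h ltxx in psil.
Qed.
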